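(* Let $\vec p=(p_1,p_2)$ satisfy $1<p_-\le p_+<\infty$, and let $\vec a,\vec b,\vec c\in\mathbb{R}^2$, $\vec\alpha\in(-1,\infty)^2$. Then the following are equivalent: (1) $S_{\vec a,\vec b,\vec c}$ is bounded from $L^{\vec p}_{\vec\alpha}(T_B\times T_B)$ to $L^\infty(T_B\times T_B)$; (2) $T_{\vec a,\vec b,\vec c}$ is bounded from $L^{\vec p}_{\vec\alpha}(T_B\times T_B)$ to $L^\infty(T_B\times T_B)$; (3) for each $i\in\{1,2\}$: $a_i>0$, $\alpha_i+1<p_i(b_i+1)$, and $c_i=n+1+a_i+b_i-\frac{n+1+\alpha_i}{p_i}$.
   Context: Let $n$ be a positive integer. For $z=(z_1,\dots,z_n)\in\mathbb{C}^n$ write $z=x+iy$ with $x,y\in\mathbb{R}^n$, $z'=(z_1,\dots,z_{n-1})$, $y'=(y_1,\dots,y_{n-1})$. Let $B=\{y\in\mathbb{R}^n: |y'|^2<y_n\}$ and $T_B=\{x+iy: x\in\mathbb{R}^n, y\in B\}$. For $z\in T_B$ put $\rho(z)=y_n-|y'|^2>0$, and for $z,u\in T_B$ put $\rho(z,u)=\frac14\big(\sum_{j=1}^{n-1}(z_j-\overline{u_j})^2-2i(z_n-\overline{u_n})\big)$; this has positive real part, and complex powers $\rho(z,u)^c$ are taken with the principal branch. $dV$ is Lebesgue measure on $\mathbb{C}^n$ and $dV_\alpha(z)=\rho(z)^\alpha dV(z)$. For $\vec p=(p_1,p_2)\in[1,\infty]^2$ and $\vec\alpha=(\alpha_1,\alpha_2)$,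 $L^{\vec p}_{\vec\alpha}(T_B\times T_B)$ is the space of measurable $f$ on $T_B\times T_B$ with finite mixed norm $\|f\|_{\vec p,\vec\alpha}=\big\{\int_{T_B}\big(\int_{T_B}|f(z,w)|^{p_1}dV_{\alpha_1}(z)\big)^{p_2/p_1}dV_{\alpha_2}(w)\big\}^{1/p_2}$, with the inner (resp. outer) integral replaced by an essential supremum in $z$ (resp. $w$) when $p_1=\infty$ (resp. $p_2=\infty$); when $\vec p=(\infty,\infty)$ this is $L^\infty(T_B\times T_B)$. Write $p_-=\min\{p_1,p_2\}$, $p_+=\max\{p_1,p_2\}$, and similarly $q_\pm$. For $\vec a=(a_1,a_2),\vec b=(b_1,b_2),\vec c=(c_1,c_2)\in\mathbb{R}^2$, $T_{\vec a,\vec b,\vec c}f(z,w)=\rho(z)^{a_1}\rho(w)^{a_2}\int_{T_B}\int_{T_B}\frac{\rho(u)^{b_1}\rho(\eta)^{b_2}}{\rho(z,u)^{c_1}\rho(w,\eta)^{c_2}}f(u,\eta)\,dV(u)\,dV(\eta)$ and $S_{\vec a,\vec b,\vec c}f(z,w)=\rho(z)^{a_1}\rho(w)^{a_2}\int_{T_B}\int_{T_B}\frac{\rho(u)^{b_1}\rho(\eta)^{b_2}}{|\rho(z,u)|^{c_1}|\rho(w,\eta)|^{c_2}}f(u,\eta)\,dV(u)\,dV(\eta)$. An operator is bounded from $X$ to $Y$ if for every $f\in X$ the defining integral converges for a.e. $(z,w)$ and $\|Tf\|_Y\le C\|f\|_X$ with $C$ independent of $f$. *)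

(* Defs.v *)
From HB Require Import structures.
From mathcomp Require Import all_boot all_order all_algebra.
From mathcomp Require Import all_classical all_reals all_analysis.
From mathcomp Require Import complex.
Set Implicit Arguments.
Unset Strict Implicit.
Unset Printing Implicit Defensive.
Import Order.TTheory GRing.Theory Num.Theory.
Import numFieldNormedType.Exports.
Local Open Scope classical_set_scope.
Local Open Scope ring_scope.

Section TubeDefs.
Context (R : realType).

(* Lebesgue (Borel) measure on R^m = m.-tuple R, built as the iterated
   product measure: lebn (m+1) A = \int lebn m (section of A at x) dx. *)
Fixpoint lebn (m : nat) : set (m.-tuple R) -> \bar R :=
  match m return set (m.-tuple R) -> \bar R with
  | 0 => fun A => if `[< A [tuple] >] then 1%E else 0%E
  | m'.+1 => fun A =>
      (\int[@lebesgue_measure R]_x @lebn m' [set t | A (cons_tuple (x : R) t)])%E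
  end.

Definition cre (w : R[i]) : R := complex.Re w.
Definition cim (w : R[i]) : R := complex.Im w.

Context (n : nat).

(* A point z = x + i y of C^n is represented by the pair (x, y). *)
Definition Cn := (n.-tuple R * n.-tuple R)%type.

Definition volC : set Cn -> \bar R := (@lebn n \x @lebn n)%E.

Definition volCC : set (Cn * Cn) -> \bar R := (volC \x volC)%E.

Definition cabs (w : R[i]) : R := Num.sqrt (cre w ^+ 2 + cim w ^+ 2).

Definition cconj (w : R[i]) : R[i] := Complex (cre w) (- cim w).

Definition zc (z : Cn) (j : nat) : R[i] := Complex (nth 0 z.1 j) (nth 0 z.2 j).

Definition rho (z : Cn) : R :=
  nth 0 z.2 n.-1 - \sum_(j < n.-1) (nth 0 z.2 j) ^+ 2.

(* the tube domain T_B over B = {|y'|^2 < y_n} *)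
Definition TB : set Cn := [set z | 0 < rho z].

Definition rho2 (z u : Cn) : R[i] :=
  Complex (4^-1) 0 *
  (\sum_(j < n.-1) (zc z j - cconj (zc u j)) ^+ 2
   - Complex 2 0 * Complex 0 1 * (zc z n.-1 - cconj (zc u n.-1))).

(* principal power w^c (principal branch of the argument); it is only used
   for Re w > 0, where the principal argument is atan (cim w / cre w). *)
Definition cpow (w : R[i]) (c : R) : R[i] :=
  let r := cabs w `^ c in
  let t := atan (cim w / cre w) in
  Complex (r * cos (c * t)) (r * sin (c * t)).

Definition kerT (b1 b2 c1 c2 : R) (z w u eta : Cn) : R[i] :=
  Complex (rho u `^ b1 * rho eta `^ b2) 0
  / (cpow (rho2 z u) c1 * cpow (rho2 w eta) c2).

Definition kerS (b1 b2 c1 c2 : R) (z w u eta : Cn) : R[i] :=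
  Complex (rho u `^ b1 * rho eta `^ b2
           / (cabs (rho2 z u) `^ c1 * cabs (rho2 w eta) `^ c2)) 0.

Definition integrand (K : Cn -> Cn -> Cn -> Cn -> R[i])
  (f : Cn * Cn -> R[i]) (z w : Cn) (q : Cn * Cn) : R[i] :=
  K z w q.1 q.2 * f q.

Definition op_conv K f (z w : Cn) : Prop :=
  volCC.-integrable (TB `*` TB) (fun q => (cre (integrand K f z w q))%:E) /\
  volCC.-integrable (TB `*` TB) (fun q => (cim (integrand K f z w q))%:E).

Definition op_val K (a1 a2 : R) f (z w : Cn) : R[i] :=
  Complex (rho z `^ a1 * rho w `^ a2) 0 *
  Complex (fine (\int[volCC]_(q in TB `*` TB) (cre (integrand K f z w q))%:E)%E)
          (fine (\int[volCC]_(q in TB `*` TB) (cim (integrand K f z w q))%:E)%E).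

Definition mixnorm (p1 p2 al1 al2 : R) (f : Cn * Cn -> R[i]) : \bar R :=
  ((\int[volC]_(w in TB)
      ((\int[volC]_(z in TB) ((cabs (f (z, w)) `^ p1 * rho z `^ al1)%:E))
         `^ (p2 / p1) * (rho w `^ al2)%:E)) `^ (p2^-1))%E.

Definition in_Lp (p1 p2 al1 al2 : R) (f : Cn * Cn -> R[i]) : Prop :=
  measurable_fun setT (fun q => cre (f q)) /\
  measurable_fun setT (fun q => cim (f q)) /\
  (mixnorm p1 p2 al1 al2 f < +oo)%E.

Definition bounded_Lp_Linf K (a1 a2 p1 p2 al1 al2 : R) : Prop :=
  exists C : R, forall f : Cn * Cn -> R[i], in_Lp p1 p2 al1 al2 f ->
    exists N : set (Cn * Cn), volCC.-negligible N /\
      forall q, (TB `*` TB) q -> ~ N q ->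
        op_conv K f q.1 q.2 /\
        cabs (op_val K a1 a2 f q.1 q.2) <= C * fine (mixnorm p1 p2 al1 al2 f).

End TubeDefs.

(* Main.v *)
Require Import Defs.
From HB Require Import structures.
From mathcomp Require Import all_boot all_order all_algebra.
From mathcomp Require Import all_classical all_reals all_analysis.
From mathcomp Require Import complex measurable_realfun measurable_fun_approximation.
From mathcomp Require Import ring lra.
Set Implicit Arguments.
Unset Strict Implicit.
Unset Printing Implicit Defensive.
Import Order.TTheory GRing.Theory Num.Theory.
Import numFieldNormedType.Exports.
Local Open Scope classical_set_scope.
Local Open Scope ring_scope.

(* With z = x + iy and u = xi + iv one has
     4 Re rho(z,u) = |x'-xi'|^2 + |y'-v'|^2 + 2 rho(z) + 2 rho(u),
     2 Im rho(z,u) = (x'-xi').(y'+v') - (x_n-xi_n).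
   Sufficiency: Hoelder's inequality in each variable reduces the claim to the
   Forelli-Rudin estimate
     int_{T_B} rho(u)^s |rho(z,u)|^{-(n+1+s+t)} dV(u) <= A rho(z)^{-t}  (s > -1, t > 0),
   whose integrand is dominated by a product of functions of the single variables
   xi_j - x_j, v_j - y_j, rho(u) and 2 Im rho(z,u); the last two become coordinates
   after shears that preserve Lebesgue measure.
   Necessity: where |Im rho| is small compared with Re rho the kernel has almost
   constant phase, so both operators are bounded below on nonnegative test functions
   g1(u) g2(eta) supported there. Boxes at scale r -> 0 and r -> oo force the value
   of c; the function rho^{-(b+1)} on {delta < rho < 1} gives the condition on b; the
   function rho^{-(n+1+al)/p} on a truncated nontangential region gives a > 0. In
   the last two cases numerator and p-th power of the norm are comparable to the same
   logarithmically divergent integral, a contradiction since p > 1. *)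

(** Throughout n = m + 1, and the coordinate of index [m] is the distinguished one. The number n + 1
    = m + 2 is the homogeneous dimension seen by a box of scale r: side sqrt r in the 2m coordinates
    of x' and y', side r in x_n and in rho. Two obstacles shape the necessity part. A bound into
    L^oo says nothing at a prescribed point, only off a null set; and the two variables are tied
    together by one mixed norm. Tensor products answer both. Their lower bound holds on a whole
    product Z1 x Z2 of positive measure, which must meet the complement of the null set, and their
    mixed norm factors. Freezing one good test function in one variable then leaves an inequality A
    <= D B^(1/p) in the other, so each index i is treated alone. Within one variable the value of c
    has to come before a > 0, whose test function is critical only for that c. Besides
    measurability, a kernel enters only through its modulus, common to S and T, and through a lower
    bound for its real part ([coercive]). One equivalence, proved for such kernels, therefore serves
    both operators, and (1) <-> (2) follows by comparing the two instances. *)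

Lemma product_measure_sigma_finite d1 d2 (T1 : measurableType d1)
    (T2 : measurableType d2) (R : realType)
    (m1 : {sigma_finite_measure set T1 -> \bar R})
    (m2 : {sigma_finite_measure set T2 -> \bar R}) :
  sigma_finite setT (m1 \x m2)%E.
Proof.
have /sigma_finiteP[F [TF ndF Foo]] := sigma_finiteT m1.
have /sigma_finiteP[G [TG ndG Goo]] := sigma_finiteT m2.
exists (fun n => F n `*` G n).
  rewrite -setXTT TF TG predeqE => -[x y]; split.
    move=> [/= [n _ Fnx] [k _ Gky]]; exists (maxn n k) => //; split.
    - by move: x Fnx; exact/subsetPset/ndF/leq_maxl.
    - by move: y Gky; exact/subsetPset/ndG/leq_maxr.
  by move=> [n _ []/= ? ?]; split; exists n.
move=> k; have [? ?] := Foo k; have [? ?] := Goo k.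
split; first exact: measurableX.
by rewrite product_measure1E// lte_mul_pinfty// ge0_fin_numE.
Qed.

(** * Lebesgue measure on tuples *)

Section LebnMeasure.
Context (R : realType).

Definition tcons (m : nat) (p : R * m.-tuple R) : m.+1.-tuple R := cons_tuple p.1 p.2.

Definition tuncons (m : nat) (t : m.+1.-tuple R) : R * m.-tuple R :=
  (tnth t ord0, [tuple of behead t]).

Lemma measurable_tcons m : measurable_fun setT (@tcons m).
Proof. exact: (measurable_cons measurable_fst measurable_snd). Qed.

Lemma measurable_tuncons m : measurable_fun setT (@tuncons m).
Proof.
apply/measurable_fun_pairP; split; first exact: measurable_tnth.
exact: measurable_behead.
Qed.

Lemma tconsK m : cancel (@tcons m) (@tuncons m).
Proof. by move=> [x t]; congr pair; apply/val_inj. Qed.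

(** [lebn] is a bare set function given by recursion. Induction identifies it with a Dirac mass for
    m = 0 and then with the image of a product measure under [tcons]. The equality holds for every
    set, measurable or not, because both sides are the same iterated integral; the measure structure
    can thus be transported to [lebn] itself. *)
Lemma lebn_isSigmaFinite m :
  exists mu : {sigma_finite_measure set (m.-tuple R) -> \bar R},
    forall A, @lebn R m A = mu A.
Proof.
elim: m => [|m [mu muE]].
  exists (@dirac _ (0.-tuple R) [tuple] R) => A /=.
  by rewrite /dirac indicE; case: asboolP => h; [rewrite mem_set|rewrite memNset].
pose nu0 : {measure set (measurableTypeR R * m.-tuple R)%type -> \bar R} :=
  (@lebesgue_measure R \x mu)%E.
pose nu1 : {measure set (m.+1.-tuple R) -> \bar R} := pushforward nu0 (@tcons m).
pose nu := nu1 (@measurable_tcons m).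
have sf : sigma_finite setT nu.
  have [F FT mF] := product_measure_sigma_finite (@lebesgue_measure R) mu.
  (* Pulling these sets back along [tcons] returns [F k], since [tuncons] is a left inverse of
     [tcons]. *)
  exists (fun k => @tuncons m @^-1` F k).
    by rewrite -preimage_bigcup -FT preimage_setT.
  move=> k; have [mFk Fk] := mF k; split.
    rewrite -[X in measurable X]setTI; exact: measurable_tuncons.
  rewrite /nu /= /pushforward -comp_preimage.
  rewrite (_ : _ \o _ = id) ?preimage_id//.
  by apply/funext => x; exact: tconsK.
pose sfm := isSigmaFinite.Build _ _ _ nu sf.
pose sfin := isSFinite.Build _ _ _ nu (sfinite_measure_sigma_finite sf).
pose nuS : {sigma_finite_measure set (m.+1.-tuple R) -> \bar R} :=
  HB.pack_for (sigma_finite_measure (m.+1.-tuple R) R)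
    (nu : set (m.+1.-tuple R) -> \bar R) (Measure.class nu) sfin sfm.
exists nuS => A /=.
rewrite /nu /= /pushforward /nu0 /product_measure1.
apply: eq_integral => x _; rewrite muE /=; congr (mu _).
by apply/seteqP; split => t /=; rewrite /xsection/= inE.
Qed.

Context (m : nat).

Let lebn0 : @lebn R m set0 = 0%E.
Proof. by have [mu ->] := lebn_isSigmaFinite m. Qed.

Let lebn_ge0 A : (0 <= @lebn R m A)%E.
Proof. by have [mu ->] := lebn_isSigmaFinite m. Qed.

Let lebn_sigma_additive : semi_sigma_additive (@lebn R m).
Proof.
have [mu muE] := lebn_isSigmaFinite m.
rewrite (_ : @lebn R m = mu); last exact/funext.
exact: measure_semi_sigma_additive.
Qed.

HB.instance Definition _ := isMeasure.Build _ _ _ (@lebn R m)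
  lebn0 lebn_ge0 lebn_sigma_additive.

Let lebn_sigma_finite : sigma_finite setT (@lebn R m).
Proof.
have [mu muE] := lebn_isSigmaFinite m.
rewrite (_ : @lebn R m = mu); last exact/funext.
exact: sigma_finiteT.
Qed.

HB.instance Definition _ := Measure_isSigmaFinite.Build _ _ _ (@lebn R m)
  lebn_sigma_finite.

End LebnMeasure.

Section VolMeasure.
Context (R : realType) (n : nat).

HB.instance Definition _ := Measure.copy (@volC R n) (@lebn R n \x @lebn R n)%E.
HB.instance Definition _ := Measure_isSigmaFinite.Build _ _ _ (@volC R n)
  (product_measure_sigma_finite (@lebn R n) (@lebn R n)).

HB.instance Definition _ := Measure.copy (@volCC R n) (@volC R n \x @volC R n)%E.
HB.instance Definition _ := Measure_isSigmaFinite.Build _ _ _ (@volCC R n)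
  (product_measure_sigma_finite (@volC R n) (@volC R n)).

End VolMeasure.

Section LebnIntegral.
Context (R : realType).

Lemma ge0_integral_lebnS (m : nat) (F : m.+1.-tuple R -> \bar R) :
  measurable_fun setT F -> (forall t, 0 <= F t)%E ->
  (\int[@lebn R m.+1]_t F t =
   \int[@lebesgue_measure R]_x \int[@lebn R m]_t F (cons_tuple x t))%E.
Proof.
move=> mF F0.
pose mu : {sigma_finite_measure set (m.-tuple R) -> \bar R} := @lebn R m.
pose nu0 : {measure set (measurableTypeR R * m.-tuple R)%type -> \bar R} :=
  (@lebesgue_measure R \x mu)%E.
have lE : @lebn R m.+1 = pushforward nu0 (@tcons R m).
  apply/funext => A; rewrite /= /pushforward /nu0 /= /product_measure1.
  apply: eq_integral => x _ /=; congr (lebn _).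
  by apply/seteqP; split => t /=; rewrite /xsection/= inE.
rewrite lE ge0_integral_pushforward//; last exact: measurable_tcons.
rewrite preimage_setT (@fubini_tonelli1 _ _ (measurableTypeR R) _ R (@lebesgue_measure R) mu)//.
  by apply: measurableT_comp => //; exact: measurable_tcons.
by move=> x; exact: F0.
Qed.

Lemma ge0_integral_lebn0 (F : 0.-tuple R -> \bar R) :
  measurable_fun setT F -> (forall t, 0 <= F t)%E ->
  (\int[@lebn R 0]_t F t = F [tuple])%E.
Proof.
move=> mF F0.
have -> : @lebn R 0 = @dirac _ (0.-tuple R) [tuple] R.
  apply/funext => A /=.
  by rewrite /dirac indicE; case: asboolP => h; [rewrite mem_set|rewrite memNset].
by rewrite integral_dirac// diracT mul1e.
Qed.

(** The image of Lebesgue measure under the translation gives half-open intervals their length, so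
    uniqueness identifies it with Lebesgue measure. *)
Lemma ge0_integral_lebesgue_shift (a : R) (f : R -> \bar R) :
  measurable_fun setT f -> (forall x, 0 <= f x)%E ->
  (\int[@lebesgue_measure R]_x f ((x : R) - a)%R = \int[@lebesgue_measure R]_x f x)%E.
Proof.
move=> mf f0.
pose s (x : measurableTypeR R) : measurableTypeR R := x - a.
have ms : measurable_fun setT s by exact: measurable_funB.
pose nu1 : {measure set (measurableTypeR R) -> \bar R} :=
  pushforward (@lebesgue_measure R) s.
pose nu := nu1 ms.
transitivity (\int[nu]_x f x)%E.
  by rewrite ge0_integral_pushforward// preimage_setT.
apply: eq_measure_integral => A mA _; apply/esym.
apply: (lebesgue_measure_unique (mu := nu)) => //.
move=> X [[c d]] /= _ <-; rewrite /nu /= /pushforward.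
rewrite (_ : s @^-1` _ = `](c + a), (d + a)]%classic); last first.
  by apply/seteqP; split => y /=; rewrite !in_itv/= /s ltrBrDr lerBlDr.
by rewrite !lebesgue_measure_itv/= !lte_fin ltrD2r -!EFinD opprD addrACA subrr addr0.
Qed.

End LebnIntegral.

Arguments lebn : simpl never.

Section Shear.
Context (R : realType).

Lemma measurable_nth m j : measurable_fun setT (fun t : m.-tuple R => nth 0 t j).
Proof.
have [jm|jm] := ltnP j m.
  rewrite (_ : (fun t : _ => _) = (fun t : m.-tuple R => tnth t (Ordinal jm))).
    exact: measurable_tnth.
  by apply/funext => t; rewrite (tnth_nth 0).
rewrite (_ : (fun t : _ => _) = cst 0); first exact: measurable_cst.
by apply/funext => t; rewrite nth_default ?size_tuple.
Qed.

(* Integrating the last coordinate first, the shear [t_m |-> t_m - Phi t']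
   disappears by translation invariance. *)
Lemma ge0_integral_lebn_shear (m : nat) (phi : nat -> R -> R) (psi : R -> R)
    (Phi : seq R -> R) (K : nat -> R) (L : R) :
  (forall j, measurable_fun setT (phi j)) -> (forall j x, 0 <= phi j x) ->
  measurable_fun setT psi -> (forall x, 0 <= psi x) ->
  measurable_fun setT (fun t : m.+1.-tuple R => Phi (take m t)) ->
  (forall j, \int[@lebesgue_measure R]_x (phi j x)%:E = (K j)%:E)%E ->
  (\int[@lebesgue_measure R]_x (psi x)%:E = L%:E)%E ->
  (\int[@lebn R m.+1]_t
     (\prod_(j < m) phi j (nth 0 t j) * psi (nth 0 t m - Phi (take m t)))%:E
   = (\prod_(j < m) K j * L)%:E)%E.
Proof.
elim: m phi Phi K => [|m IH] phi Phi K mphi phi0 mpsi psi0 mPhi phiK psiL.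
- rewrite ge0_integral_lebnS; last 2 first.
  + apply/measurable_EFinP; under eq_fun do rewrite big_ord0 mul1r.
    apply: measurableT_comp => //; apply: measurable_funB => //.
    exact: measurable_nth.
  + by move=> t; rewrite big_ord0 mul1r lee_fin.
  rewrite big_ord0 mul1r -psiL -[RHS](ge0_integral_lebesgue_shift (Phi [::])); last 2 first.
  + exact/measurable_EFinP.
  + by move=> x; rewrite lee_fin.
  apply: eq_integral => x _; rewrite ge0_integral_lebn0; last 2 first.
  + apply/measurable_EFinP; under eq_fun do rewrite big_ord0 mul1r take0 /=.
    exact: measurable_cst.
  + by move=> t; rewrite big_ord0 mul1r lee_fin.
  by rewrite big_ord0 mul1r take0.
have mG k (p : nat -> R -> R) (P : seq R -> R) : (forall j, measurable_fun setT (p j)) ->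
    measurable_fun setT (fun t : k.+1.-tuple R => P (take k t)) ->
    measurable_fun setT (fun t : k.+1.-tuple R =>
      (\prod_(j < k) p j (nth 0 t j) * psi (nth 0 t k - P (take k t)))%:E).
  move=> mp mP; apply/measurable_EFinP; apply: measurable_funM.
    apply: measurable_prod => j _; apply: measurableT_comp => //.
    exact: measurable_nth.
  apply: measurableT_comp => //; apply: measurable_funB => //.
  exact: measurable_nth.
rewrite ge0_integral_lebnS; last 2 first.
- exact: mG.
- by move=> t; rewrite lee_fin mulr_ge0// prodr_ge0.
pose C := \prod_(j < m) K j.+1 * L.
transitivity (\int[@lebesgue_measure R]_x ((phi 0%N x)%:E * C%:E))%E.
  apply: eq_integral => x _.
  (* Freezing the first coordinate x leaves a shear of the same kind, by s |-> Phi (x :: s), in one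
     dimension less. This is why [Phi] takes a sequence of unspecified length. *)
  have mP : measurable_fun setT (fun t : m.+1.-tuple R => Phi (x :: take m t)).
    apply: (measurableT_comp (f := fun s : m.+2.-tuple R => Phi (take m.+1 s))
      (g := fun t : m.+1.-tuple R => [the m.+2.-tuple R of x :: t])) => //.
    exact: measurable_cons.
  rewrite -(IH (fun j => phi j.+1) (fun s => Phi (x :: s)) (fun j => K j.+1))//.
  rewrite -ge0_integralZl//; last 3 first.
  - exact: (mG m (fun j => phi j.+1) (fun s => Phi (x :: s))).
  - by move=> t _; rewrite lee_fin mulr_ge0// prodr_ge0.
  - by rewrite lee_fin.
  apply: eq_integral => t _; rewrite -EFinM; congr EFin.
  by rewrite big_ord_recl /= -mulrA.
rewrite ge0_integralZr//; last 3 first.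
- by apply/measurable_EFinP; exact: mphi.
- by move=> x _; rewrite lee_fin.
- rewrite lee_fin mulr_ge0 ?prodr_ge0//.
    by move=> j _; rewrite -lee_fin -phiK integral_ge0// => x _; rewrite lee_fin.
  by rewrite -lee_fin -psiL integral_ge0// => x _; rewrite lee_fin.
by rewrite phiK -EFinM /C mulrA big_ord_recl.
Qed.

End Shear.

(** * Integration over the tube domain in sheared coordinates, and the expansion of rho(z,u) *)

Section Geometry.
Context (R : realType) (m : nat).
Notation C := (Cn R m.+1).
Implicit Types z u : C.

Lemma measurable_nth1 j : measurable_fun setT (fun z : C => nth 0 z.1 j).
Proof. by apply: measurableT_comp (@measurable_nth R m.+1 j) _. Qed.

Lemma measurable_nth2 j : measurable_fun setT (fun z : C => nth 0 z.2 j).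
Proof. by apply: measurableT_comp (@measurable_nth R m.+1 j) _. Qed.

Lemma measurable_rho : measurable_fun setT (@rho R m.+1).
Proof.
apply: measurable_funB; first exact: measurable_nth2.
by apply: measurable_sum => j; apply: measurable_funX; exact: measurable_nth2.
Qed.

Lemma measurable_TB : measurable (@TB R m.+1).
Proof.
rewrite -[X in measurable X]setTI.
rewrite (_ : @TB R _ = @rho R m.+1 @^-1` `]0, +oo[%classic); last first.
  by apply/seteqP; split => z /=; rewrite in_itv/= andbT.
exact: measurable_rho.
Qed.

(** The imaginary part is integrated last: the shear of x_n will depend on y, whereas that of y_n
    does not depend on x. *)
Lemma ge0_integral_volC (F : C -> \bar R) :
  measurable_fun setT F -> (forall u, 0 <= F u)%E ->
  (\int[@volC R m.+1]_u F u =
   \int[@lebn R m.+1]_v \int[@lebn R m.+1]_t F (t, v))%E.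
Proof.
by move=> mF F0; exact: (fubini_tonelli2 (m1 := @lebn R m.+1) (m2 := @lebn R m.+1)).
Qed.

(** All explicit integrals over the domain, the Forelli-Rudin majorant as well as the volumes of
    boxes, are instances of this. At fixed y the shear in x_n is removed and the inner integral is a
    constant; [rho] is in turn a shear of y_n by |y'|^2, so that (y', rho) serve as coordinates with
    Jacobian 1. *)
Lemma ge0_integral_volC_shear (phi : nat -> R -> R) (psi : R -> R)
    (phi' : nat -> R -> R) (chi : R -> R)
    (Phi : m.+1.-tuple R -> seq R -> R) (K K' : nat -> R) (L L' : R) :
  (forall j, measurable_fun setT (phi j)) -> (forall j x, 0 <= phi j x) ->
  measurable_fun setT psi -> (forall x, 0 <= psi x) ->
  (forall j, measurable_fun setT (phi' j)) -> (forall j x, 0 <= phi' j x) ->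
  measurable_fun setT chi -> (forall x, 0 <= chi x) ->
  measurable_fun setT (fun u : C => Phi u.2 (take m u.1)) ->
  (forall j, \int[@lebesgue_measure R]_x (phi j x)%:E = (K j)%:E)%E ->
  (\int[@lebesgue_measure R]_x (psi x)%:E = L%:E)%E ->
  (forall j, \int[@lebesgue_measure R]_x (phi' j x)%:E = (K' j)%:E)%E ->
  (\int[@lebesgue_measure R]_x (chi x)%:E = L'%:E)%E ->
  (\int[@volC R m.+1]_u
     ((\prod_(j < m) phi j (nth 0 u.1 j) * psi (nth 0 u.1 m - Phi u.2 (take m u.1))) *
      (\prod_(j < m) phi' j (nth 0 u.2 j) * chi (rho u)))%:E
   = ((\prod_(j < m) K j * L) * (\prod_(j < m) K' j * L'))%:E)%E.
Proof.
move=> mphi phi0 mpsi psi0 mphi' phi'0 mchi chi0 mPhi phiK psiL phiK' chiL.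
have mA : measurable_fun setT (fun u : C =>
    \prod_(j < m) phi j (nth 0 u.1 j) * psi (nth 0 u.1 m - Phi u.2 (take m u.1))).
  apply: measurable_funM.
    apply: measurable_prod => j _; apply: measurableT_comp => //.
    exact: measurable_nth1.
  apply: measurableT_comp => //; apply: measurable_funB => //.
  exact: measurable_nth1.
have mB : measurable_fun setT (fun u : C =>
    \prod_(j < m) phi' j (nth 0 u.2 j) * chi (rho u)).
  apply: measurable_funM.
    apply: measurable_prod => j _; apply: measurableT_comp => //.
    exact: measurable_nth2.
  by apply: measurableT_comp => //; exact: measurable_rho.
have L0 : 0 <= \prod_(j < m) K j * L.
  rewrite mulr_ge0 ?prodr_ge0//.
    by move=> j _; rewrite -lee_fin -phiK integral_ge0// => x _; rewrite lee_fin.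
  by rewrite -lee_fin -psiL integral_ge0// => x _; rewrite lee_fin.
pose Phi2 (s : seq R) := \sum_(j < m) (nth 0 s j) ^+ 2.
have rhoE t (v : m.+1.-tuple R) : rho ((t, v) : C) = nth 0 v m - Phi2 (take m v).
  rewrite /rho /=; congr (_ - _); apply: eq_bigr => j _.
  by rewrite nth_take.
rewrite ge0_integral_volC; last 2 first.
- by apply/measurable_EFinP; apply: measurable_funM.
- by move=> u; rewrite lee_fin !mulr_ge0// prodr_ge0.
have mP2 : measurable_fun setT (fun t : m.+1.-tuple R => Phi2 (take m t)).
  rewrite /Phi2; under eq_fun do under eq_bigr do rewrite nth_take//.
  by apply: measurable_sum => j; apply: measurable_funX; exact: measurable_nth.
transitivity (\int[@lebn R m.+1]_v ((\prod_(j < m) K j * L)%:E *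
    (\prod_(j < m) phi' j (nth 0 v j) * chi (nth 0 v m - Phi2 (take m v)))%:E))%E.
  apply: eq_integral => v _ /=.
  rewrite -(@ge0_integral_lebn_shear R m phi psi (Phi v) K L)//; last first.
    exact: (measurableT_comp mPhi (pair2_measurable v)).
  rewrite -ge0_integralZr//; last 3 first.
  - apply/measurable_EFinP.
    exact: (measurableT_comp mA (pair2_measurable v)).
  - by move=> t _; rewrite lee_fin mulr_ge0// prodr_ge0.
  - by rewrite lee_fin mulr_ge0// prodr_ge0.
  by apply: eq_integral => t _; rewrite -EFinM rhoE.
rewrite ge0_integralZl//; last 2 first.
- apply/measurable_EFinP; apply: measurable_funM.
    apply: measurable_prod => j _; apply: measurableT_comp => //.
    exact: measurable_nth.
  apply: measurableT_comp => //; apply: measurable_funB => //.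
  exact: measurable_nth.
- by move=> t _; rewrite lee_fin mulr_ge0// prodr_ge0.
by rewrite (ge0_integral_lebn_shear mphi' phi'0 mchi chi0 mP2 phiK' chiL) -EFinM.
Qed.

(** The real part becomes a sum of visibly nonnegative terms through -(y + v)^2 = (y - v)^2 - 2y^2 -
    2v^2 in each of the first m coordinates: the last two squares combine with y_n + v_n to form
    rho(z) and rho(u). *)
Lemma rho2E z u : rho2 z u = Complex
  (4^-1 * (\sum_(j < m) ((nth 0 z.1 j - nth 0 u.1 j) ^+ 2 +
                         (nth 0 z.2 j - nth 0 u.2 j) ^+ 2) + 2 * rho z + 2 * rho u))
  (2^-1 * (\sum_(j < m) (nth 0 z.1 j - nth 0 u.1 j) * (nth 0 z.2 j + nth 0 u.2 j)
           - (nth 0 z.1 m - nth 0 u.1 m))).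
Proof.
have sumE (F : 'I_m -> R[i]) : \sum_j F j =
    Complex (\sum_j cre (F j)) (\sum_j cim (F j)).
  elim/big_rec3: _ => [//|j a b c _ ->].
  by case: (F j).
rewrite /rho2 /= sumE; simpc; rewrite /rho /=; congr Complex.
  have -> : \sum_(j < m) cre ((zc z j - cconj (zc u j)) ^+ 2) =
    \sum_(j < m) ((nth 0 z.1 j - nth 0 u.1 j) ^+ 2 + (nth 0 z.2 j - nth 0 u.2 j) ^+ 2)
    - 2 * \sum_(j < m) (nth 0 z.2 j) ^+ 2 - 2 * \sum_(j < m) (nth 0 u.2 j) ^+ 2.
    rewrite !mulr_sumr -!sumrB; apply: eq_bigr => j _.
    by rewrite expr2 /zc /cconj /cre /cim /=; ring.
  by ring.
have -> : \sum_(j < m) cim ((zc z j - cconj (zc u j)) ^+ 2) =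
    2 * \sum_(j < m) (nth 0 z.1 j - nth 0 u.1 j) * (nth 0 z.2 j + nth 0 u.2 j).
  rewrite mulr_sumr; apply: eq_bigr => j _.
  by rewrite expr2 /zc /cconj /cre /cim /=; ring.
by field.
Qed.

End Geometry.

(** * One-dimensional integrals *)

Section PowerIntegrals.
Context (R : realType).
Notation leb := (@lebesgue_measure R).

Lemma integral_powR_cc (s a b : R) : s != -1 -> 0 < a -> a <= b ->
  (\int[leb]_(x in `[a, b]) (x `^ s)%:E =
   ((b `^ (s + 1) - a `^ (s + 1)) / (s + 1))%:E)%E.
Proof.
move=> s1 a0; rewrite le_eqVlt => /predU1P[<-|ab].
  by rewrite set_itv1 integral_set1 subrr mul0r.
have s10 : s + 1 != 0 by rewrite addr_eq0.
pose F x := (s + 1)^-1 * x `^ (s + 1).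
have dF (x : R) : 0 < x -> is_derive x 1 F (x `^ s).
  move=> x0.
  have -> : x `^ s = (s + 1)^-1 *: ((s + 1) * x `^ (s + 1 - 1)).
    by rewrite addrK /GRing.scale/= mulKf.
  by apply: is_deriveZ; exact: is_derive1_powR.
have cF (x : R) : 0 < x -> {for x, continuous F}.
  move=> x0; apply/differentiable_continuous/derivable1_diffP.
  by have [] := dF _ x0.
rewrite (continuous_FTC2 (F := F)) //.
- by rewrite -EFinB /F -mulrBr mulrC.
- apply: derivable_within_continuous => x; rewrite in_itv/= => /andP[ax _].
  by apply: derivable_powR; rewrite in_itv/= andbT (lt_le_trans a0).
- split.
  + move=> x; rewrite in_itv/= => /andP[ax _].
    by have [] := dF _ (lt_trans a0 ax).
  + by apply: cvg_at_right_filter; exact: cF.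
  + by apply: cvg_at_left_filter; apply: cF; exact: lt_trans ab.
- move=> x; rewrite in_itv/= => /andP[ax _].
  by rewrite derive1E; apply: derive_val; exact: dF (lt_trans a0 ax).
Qed.

Lemma integral_invr_cc (a b : R) : 0 < a -> a < b ->
  (\int[leb]_(x in `[a, b]) (x^-1)%:E = (ln b - ln a)%:E)%E.
Proof.
move=> a0 ab.
have cF (x : R) : 0 < x -> {for x, continuous (@ln R)}.
  by move=> x0; exact: continuous_ln.
rewrite (continuous_FTC2 (F := @ln R)) //.
- apply: derivable_within_continuous => x; rewrite in_itv/= => /andP[ax _].
  by apply: derivableV => //; rewrite gt_eqF// (lt_le_trans a0).
- split.
  + move=> x; rewrite in_itv/= => /andP[ax _].
    by have [] := is_derive1_ln (lt_trans a0 ax).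
  + by apply: cvg_at_right_filter; exact: cF.
  + by apply: cvg_at_left_filter; apply: cF; exact: lt_trans ab.
- move=> x; rewrite in_itv/= => /andP[ax _].
  by rewrite derive1E; apply: derive_val; exact: is_derive1_ln (lt_trans a0 ax).
Qed.

(** Monotone convergence: an upper bound for an improper integral may be checked on an exhaustion by
    compact intervals, where an antiderivative is available. *)
Lemma integral_bigcup_le (F : (set R)^nat) (f : R -> \bar R) (B : \bar R) :
  nondecreasing_seq F -> (forall i, measurable (F i)) ->
  measurable_fun setT f -> (forall x, 0 <= f x)%E ->
  (forall i, \int[leb]_(x in F i) f x <= B)%E ->
  (\int[leb]_(x in \bigcup_i F i) f x <= B)%E.
Proof.
move=> ndF mF mf f0 FB.
have mfF i : measurable_fun (F i) f by exact: measurable_funTS.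
have h := @ge0_nondecreasing_set_cvg_integral _ (measurableTypeR R) _ F f leb ndF mF mfF
  (fun _ x _ => f0 x).
rewrite -(cvg_lim (@ereal_hausdorff R) h).
by apply: lime_le; [apply/cvg_ex; exists (\int[leb]_(x in \bigcup_i F i) f x)%E
                   |exact: nearW].
Qed.

Lemma integral_powR_near0 (s r : R) : -1 < s -> 0 < r ->
  (\int[leb]_(x in `[0%R, r]) (x `^ s)%:E <= (r `^ (s + 1) / (s + 1))%:E)%E.
Proof.
move=> s1 r0.
have s10 : 0 < s + 1 by rewrite -ltrBlDr sub0r.
have mp : measurable_fun setT (fun x : R => (x `^ s)%:E).
  by apply/measurable_EFinP; exact: measurable_powR.
(* The null point 0 is dropped so that compact intervals inside the open half-line exhaust the
   domain. *)
rewrite -integral_itv_obnd_cbnd; last exact: measurable_funTS.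
have -> : `]0, r]%classic = \bigcup_i `[(r / i.+1%:R), r]%classic.
  apply/seteqP; split => x /=.
    rewrite in_itv/= => /andP[x0 xr]; exists (Num.truncn (r / x)) => //=.
    rewrite in_itv/= xr andbT ler_pdivrMr ?ltr0n// -ler_pdivrMl// mulrC.
    exact/ltW/truncnS_gt.
  move=> [i _] /=; rewrite !in_itv/= => /andP[+ ->]; rewrite andbT.
  by apply: lt_le_trans; rewrite divr_gt0 ?ltr0n.
apply: integral_bigcup_le => //.
- move=> i j ij; apply/subsetPset => x /=; rewrite !in_itv/= => /andP[+ ->].
  rewrite andbT; apply: le_trans; rewrite ler_pM2l// lef_pV2 ?posrE ?ltr0n//.
  by rewrite ler_nat.
- by move=> x; rewrite lee_fin powR_ge0.
move=> i; rewrite integral_powR_cc ?gt_eqF//.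
- rewrite lee_fin ler_pM2r ?invr_gt0// gerBl.
  exact: powR_ge0.
- by rewrite divr_gt0 ?ltr0n.
- by rewrite ler_pdivrMr ?ltr0n// ler_peMr ?ler1n// ltW.
Qed.

Lemma integral_powR_neary (e r : R) : 0 < e -> 0 < r ->
  (\int[leb]_(x in `[r, +oo[) (x `^ (- 1 - e))%:E <= (r `^ (- e) / e)%:E)%E.
Proof.
move=> e0 r0.
have mp : measurable_fun setT (fun x : R => (x `^ (- 1 - e))%:E).
  by apply/measurable_EFinP; exact: measurable_powR.
have -> : `[r, +oo[%classic = \bigcup_i `[r, r + i%:R]%classic.
  apply/seteqP; split => x /=.
    rewrite in_itv/= andbT => rx; exists (Num.truncn (x - r)).+1 => //=.
    by rewrite in_itv/= rx/= -lerBlDl; exact/ltW/truncnS_gt.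
  by move=> [i _] /=; rewrite !in_itv/= => /andP[->].
apply: integral_bigcup_le => //.
- move=> i j ij; apply/subsetPset => x /=; rewrite !in_itv/= => /andP[->].
  by move=> /le_trans; apply; rewrite lerD2l ler_nat.
- by move=> x; rewrite lee_fin powR_ge0.
move=> i; rewrite integral_powR_cc//; last 2 first.
- by rewrite lt_eqF// ltrBlDr ltrDl.
- by rewrite lerDl.
have -> : - 1 - e + 1 = - e :> R by ring.
rewrite lee_fin invrN mulrN -mulNr opprB ler_pM2r ?invr_gt0// gerBl.
exact: powR_ge0.
Qed.

Lemma ge0_integral_lebesgue_opp (f : R -> \bar R) :
  measurable_fun setT f -> (forall x, 0 <= f x)%E ->
  (\int[leb]_x f (- (x : R))%R = \int[leb]_x f x)%E.
Proof.
move=> mf f0.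
pose s (x : measurableTypeR R) : measurableTypeR R := - x.
have ms : measurable_fun setT s by exact: oppr_measurable.
pose nu1 : {measure set (measurableTypeR R) -> \bar R} := pushforward leb s.
pose nu := nu1 ms.
transitivity (\int[nu]_x f x)%E.
  by rewrite ge0_integral_pushforward// preimage_setT.
apply: eq_measure_integral => A mA _; apply/esym.
apply: (lebesgue_measure_unique (mu := nu)) => //.
move=> X [[c d]] /= _ <-; rewrite /nu /= /pushforward.
(* Reflection moves the closed end to the other side, which does not affect the length. *)
rewrite (_ : s @^-1` _ = `[(- d), (- c)[%classic); last first.
  by apply/seteqP; split => y /=; rewrite !in_itv/= /s ltrNr lerNl andbC.
by rewrite !lebesgue_measure_itv/= !lte_fin ltrN2 -!EFinD opprK addrC.
Qed.

(** On t >= 0 this is t^s max(t, r)^(-s-1-e), doubled at t = r where the two pieces overlap, and it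
    vanishes for t < 0. The first piece is integrable at 0 for s > -1, the second at infinity for e
    > 0, and by homogeneity both contribute a multiple of r^(-e). *)
Definition two_powers (s e r : R) : R -> R := fun t =>
  ((fun t => r `^ (- s - 1 - e) * t `^ s) \_ `[0, r]) t +
  ((fun t => t `^ (- 1 - e)) \_ `[r, +oo[) t.

Lemma measurable_two_powers s e r : measurable_fun setT (two_powers s e r).
Proof.
apply: measurable_funD.
  apply/(measurable_restrictT _ _).1 => //; apply: measurable_funTS.
  by apply: measurable_funM => //; exact: measurable_powR.
apply/(measurable_restrictT _ _).1 => //; apply: measurable_funTS.
exact: measurable_powR.
Qed.

Lemma two_powers_ge0 s e r t : 0 <= two_powers s e r t.
Proof.
rewrite /two_powers /patch; apply: addr_ge0; case: ifP => // _;
  rewrite ?mulr_ge0 ?powR_ge0//.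
Qed.

Lemma integral_two_powers s e r : -1 < s -> 0 < e -> 0 < r ->
  (\int[leb]_t (two_powers s e r t)%:E <= (((s + 1)^-1 + e^-1) * r `^ (- e))%:E)%E.
Proof.
move=> s1 e0 r0; rewrite /two_powers.
have s10 : 0 < s + 1 by rewrite -ltrBlDr sub0r.
set f1 := (fun t => _ * _); set f2 := (fun t => t `^ _).
have mf1 : measurable_fun setT f1.
  by apply: measurable_funM => //; exact: measurable_powR.
have mf2 : measurable_fun setT f2 by exact: measurable_powR.
under eq_integral do rewrite EFinD.
rewrite ge0_integralD//; last 4 first.
- by move=> x _; rewrite lee_fin /patch; case: ifP => // _; rewrite mulr_ge0 ?powR_ge0.
- apply/measurable_EFinP/(measurable_restrictT _ _).1 => //.
  exact: measurable_funTS.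
- by move=> x _; rewrite lee_fin /patch; case: ifP => // _; rewrite powR_ge0.
- apply/measurable_EFinP/(measurable_restrictT _ _).1 => //.
  exact: measurable_funTS.
rewrite mulrDl EFinD; apply: leeD; last first.
  apply: le_trans (_ : (\int[leb]_(x in `[r, +oo[) (f2 x)%:E <= _)%E).
    by rewrite [leRHS]integral_mkcond restrict_EFin.
  by rewrite mulrC; exact: integral_powR_neary.
apply: (@le_trans _ _ (\int[leb]_(x in `[0%R, r]) (f1 x)%:E)%E).
  by rewrite [leRHS]integral_mkcond restrict_EFin.
rewrite /f1 /=; under eq_integral do rewrite EFinM.
rewrite ge0_integralZl//; last 3 first.
- by apply/measurable_EFinP; apply: measurable_funTS; exact: measurable_powR.
- by move=> x _; rewrite lee_fin powR_ge0.
- by rewrite lee_fin powR_ge0.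
apply: (@le_trans _ _ ((r `^ (- s - 1 - e))%:E * (r `^ (s + 1) / (s + 1))%:E)%E).
  by apply: lee_pmul => //; [rewrite lee_fin powR_ge0|apply: integral_ge0 => x _; rewrite lee_fin powR_ge0|exact: integral_powR_near0].
rewrite -EFinM lee_fin mulrA -powRD; last by rewrite (gt_eqF r0) implybT.
have -> : - s - 1 - e + (s + 1) = - e by ring.
by rewrite mulrC.
Qed.

End PowerIntegrals.

(** * Forelli-Rudin estimates *)

Section KernelSize.
Context (R : realType) (m : nat).
Notation C := (Cn R m.+1).
Implicit Types (z u : C) (w : R[i]).

Lemma le_cre_cabs w : `|cre w| <= cabs w.
Proof. by rewrite -sqrtr_sqr ler_wsqrtr// lerDl sqr_ge0. Qed.

Lemma le_cim_cabs w : `|cim w| <= cabs w.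
Proof. by rewrite -sqrtr_sqr ler_wsqrtr// lerDr sqr_ge0. Qed.

Lemma cabs_ge0 w : 0 <= cabs w.
Proof. exact: sqrtr_ge0. Qed.

Lemma cabs_le_add w : cabs w <= `|cre w| + `|cim w|.
Proof.
rewrite -(ger0_norm (addr_ge0 (normr_ge0 _) (normr_ge0 _))) -sqrtr_sqr ler_wsqrtr//.
rewrite sqrrD !real_normK ?num_real// -addrA [X in _ <= _ + X]addrC addrA lerDl.
by rewrite mulrn_wge0// mulr_ge0.
Qed.

Lemma measurable_sqrtr : measurable_fun setT (@Num.sqrt R).
Proof. by apply: continuous_measurable_fun; exact: sqrt_continuous. Qed.

Lemma measurable_cre_rho2 z : measurable_fun setT (fun u : C => cre (rho2 z u)).
Proof.
under eq_fun do rewrite rho2E /cre /=.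
apply: measurable_funM => //; apply: measurable_funD; last first.
  by apply: measurable_funM => //; exact: measurable_rho.
apply: measurable_funD => //.
apply: measurable_sum => j; apply: measurable_funD; apply: measurable_funX;
  apply: measurable_funB => //; [exact: measurable_nth1|exact: measurable_nth2].
Qed.

Lemma measurable_cim_rho2 z : measurable_fun setT (fun u : C => cim (rho2 z u)).
Proof.
under eq_fun do rewrite rho2E /cim /=.
apply: measurable_funM => //; apply: measurable_funB; last first.
  by apply: measurable_funB => //; exact: measurable_nth1.
apply: measurable_sum => j; apply: measurable_funM.
  by apply: measurable_funB => //; exact: measurable_nth1.
by apply: measurable_funD => //; exact: measurable_nth2.
Qed.

Lemma measurable_cabs d (T : measurableType d) (f : T -> R[i]) :
  measurable_fun setT (fun x => cre (f x)) -> measurable_fun setT (fun x => cim (f x)) ->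
  measurable_fun setT (fun x => cabs (f x)).
Proof.
move=> mr mi; apply: measurableT_comp measurable_sqrtr _.
by apply: measurable_funD; apply: measurable_funX.
Qed.

Lemma measurable_cabs_rho2 z : measurable_fun setT (fun u : C => cabs (rho2 z u)).
Proof.
by apply: measurable_cabs; [exact: measurable_cre_rho2|exact: measurable_cim_rho2].
Qed.

Lemma rho_add_le_cre z u : 2^-1 * (rho z + rho u) <= cre (rho2 z u).
Proof.
rewrite rho2E /cre /=.
set S := \sum_(j < m) _; have S0 : 0 <= S by apply: sumr_ge0 => j _; rewrite addr_ge0 ?sqr_ge0.
lra.
Qed.

Lemma cre_rho2_gt0 z u : TB z -> TB u -> 0 < cre (rho2 z u).
Proof.
rewrite /TB /= => z0 u0; apply: lt_le_trans (rho_add_le_cre z u); lra.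
Qed.

Lemma cabs_rho2_gt0 z u : TB z -> TB u -> 0 < cabs (rho2 z u).
Proof.
move=> z0 u0; apply: lt_le_trans (le_cre_cabs _).
by rewrite normr_gt0 gt_eqF// cre_rho2_gt0.
Qed.

Lemma cre_rho2_le z u : TB z -> TB u -> cre (rho2 z u) <= cabs (rho2 z u).
Proof.
by move=> z0 u0; rewrite (le_trans _ (le_cre_cabs _))// ler_norm.
Qed.

(** This bound and the next three show that the single quantity 4 |rho(z,u)| dominates every
    coordinate used in the integration; the common constant 4 is what lets the majorant be a
    product. *)
Lemma rho1_le_cabs z u : TB z -> TB u -> rho z <= 4 * cabs (rho2 z u).
Proof.
move=> z0 u0; have := rho_add_le_cre z u; have := cre_rho2_le z0 u0.
by move: z0 u0; rewrite /TB /=; lra.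
Qed.

Lemma rho2_le_cabs z u : TB z -> TB u -> rho u <= 4 * cabs (rho2 z u).
Proof.
move=> z0 u0; have := rho_add_le_cre z u; have := cre_rho2_le z0 u0.
by move: z0 u0; rewrite /TB /=; lra.
Qed.

Lemma sqr_le_cabs z u (j : 'I_m) : TB z -> TB u ->
  (nth 0 z.1 j - nth 0 u.1 j) ^+ 2 + (nth 0 z.2 j - nth 0 u.2 j) ^+ 2
    <= 4 * cabs (rho2 z u).
Proof.
move=> z0 u0; have := cre_rho2_le z0 u0; rewrite {1}rho2E /cre /=.
rewrite (bigD1 j)//=; set S := \sum_(i < m | _) _.
have S0 : 0 <= S by apply: sumr_ge0 => i _; rewrite addr_ge0 ?sqr_ge0.
by move: z0 u0; rewrite /TB /=; lra.
Qed.

(** The left side is |2 Im rho(z,u)|, arranged as a shear of the last real coordinate of [u] as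
    required by [ge0_integral_volC_shear]. *)
Lemma shear_le_cabs z u :
  `|nth 0 u.1 m - (nth 0 z.1 m - \sum_(j < m)
     (nth 0 z.1 j - nth 0 u.1 j) * (nth 0 z.2 j + nth 0 u.2 j))| <= 4 * cabs (rho2 z u).
Proof.
have := le_cim_cabs (rho2 z u); have := cabs_ge0 (rho2 z u).
rewrite {2}rho2E /cim /= normrM (@ger0_norm _ 2^-1)//.
set S := \sum_(j < m) _.
have -> : S - (nth 0 z.1 m - nth 0 u.1 m) = nth 0 u.1 m - (nth 0 z.1 m - S) by ring.
lra.
Qed.

(** The symmetrised case s = 0, for coordinate differences, which take both signs. *)
Definition even_two_powers (e r : R) : R -> R :=
  fun x => two_powers 0 e r x + two_powers 0 e r (- x).

Lemma measurable_even_two_powers e r : measurable_fun setT (even_two_powers e r).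
Proof.
apply: measurable_funD; first exact: measurable_two_powers.
by apply: measurableT_comp => //; exact: measurable_two_powers.
Qed.

Lemma even_two_powers_ge0 e r x : 0 <= even_two_powers e r x.
Proof. by rewrite addr_ge0 ?two_powers_ge0. Qed.

Lemma integral_even_two_powers e r : 0 < e -> 0 < r ->
  (\int[@lebesgue_measure R]_x (even_two_powers e r x)%:E
     <= (2 * (1 + e^-1) * r `^ (- e))%:E)%E.
Proof.
move=> e0 r0; rewrite /even_two_powers; under eq_integral do rewrite EFinD.
have mt : measurable_fun setT (EFin \o two_powers 0 e r).
  by apply/measurable_EFinP; exact: measurable_two_powers.
rewrite ge0_integralD//; last 3 first.
- by move=> x _; rewrite lee_fin two_powers_ge0.
- by move=> x _; rewrite lee_fin two_powers_ge0.
- apply/measurable_EFinP; apply: measurableT_comp => //.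
  exact: measurable_two_powers.
rewrite [X in (_ + X <= _)%E](ge0_integral_lebesgue_opp mt); last first.
  by move=> x; rewrite lee_fin two_powers_ge0.
have h := @integral_two_powers R 0 e r.
rewrite add0r invr1 in h.
rewrite -mulrA mulr_natl mulr2n EFinD.
by apply: leeD; apply: h => //; rewrite ltrN10.
Qed.

Lemma powR_antitone (e a b : R) : e <= 0 -> 0 < a -> a <= b -> b `^ e <= a `^ e.
Proof.
move=> e0 a0 ab; rewrite -(opprK e) !(powRN _ (- e)) lef_pV2 ?posrE ?powR_gt0//.
- by apply: ge0_ler_powR; rewrite ?oppr_ge0 ?nnegrE ?(ltW a0)//; apply: le_trans (ltW a0) ab.
- exact: lt_le_trans ab.
Qed.

(** Since A >= max(t, r) and the exponent -s-1-e is negative, A may be replaced by max(t, r). *)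
Lemma powR_le_two_powers (s e r t A : R) : -1 < s -> 0 < e -> 0 < r -> 0 <= t ->
  r <= A -> t <= A -> t `^ s * A `^ (- s - 1 - e) <= two_powers s e r t.
Proof.
move=> s1 e0 r0 t0 rA tA; rewrite /two_powers /patch.
have se : - s - 1 - e <= 0 by lra.
have [tr|rt] := leP t r.
  rewrite mem_set/=; last by rewrite in_itv/= t0 tr.
  rewrite -[leLHS]addr0; apply: lerD; last by case: ifP => // _; exact: powR_ge0.
  by rewrite mulrC ler_wpM2r ?powR_ge0//; exact: powR_antitone.
rewrite [X in _ <= _ + X]ifT; last by rewrite mem_set//= in_itv/= andbT ltW.
rewrite -[leLHS]add0r; apply: lerD.
  by case: ifP => // _; rewrite mulr_ge0 ?powR_ge0.
have tp : 0 < t := lt_trans r0 rt.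
have -> : - 1 - e = s + (- s - 1 - e) by ring.
rewrite powRD; last by rewrite (gt_eqF tp) implybT.
by rewrite ler_wpM2l ?powR_ge0//; exact: powR_antitone.
Qed.

Lemma powR_le_even_two_powers (e r x A : R) : 0 < e -> 0 < r ->
  r <= A -> `|x| <= A -> A `^ (- 1 - e) <= even_two_powers e r x.
Proof.
move=> e0 r0 rA xA; rewrite /even_two_powers.
have h y : 0 <= y -> y <= A -> A `^ (- 1 - e) <= two_powers 0 e r y.
  move=> y0 yA; have := @powR_le_two_powers 0 e r y A.
  by rewrite powRr0 mul1r oppr0 add0r; apply => //; rewrite ltrN10.
have [x0|x0] := leP 0 x.
  rewrite -[leLHS]addr0; apply: lerD; last exact: two_powers_ge0.
  by apply: h => //; rewrite (le_trans (ler_norm _)).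
rewrite -[leLHS]add0r; apply: lerD; first exact: two_powers_ge0.
by apply: h; [rewrite oppr_ge0 ltW|rewrite -(ltr0_norm x0)].
Qed.

Lemma prodr_const_nat (x : R) : \prod_(j < m) x = x ^+ m.
Proof. by rewrite prodr_const card_ord. Qed.

(* The exponent is shared out among the 2m + 2 coordinates, each
   receiving just enough to be integrable plus a surplus e. *)
Lemma forelli_rudin_pointwise (s e : R) z u : -1 < s -> 0 < e -> TB z -> TB u ->
  rho u `^ s * (4 * cabs (rho2 z u)) `^ (- (m.+2%:R + s + 2 * m.+1%:R * e)) <=
  (\prod_(j < m) even_two_powers (2 * e) (Num.sqrt (rho z)) (nth 0 u.1 j - nth 0 z.1 j) *
   even_two_powers e (rho z) (nth 0 u.1 m - (nth 0 z.1 m - \sum_(j < m)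
     (nth 0 z.1 j - nth 0 u.1 j) * (nth 0 z.2 j + nth 0 u.2 j)))) *
  (\prod_(j < m) even_two_powers (2 * e) (Num.sqrt (rho z)) (nth 0 u.2 j - nth 0 z.2 j) *
   two_powers s e (rho z) (rho u)).
Proof.
move=> s1 e0 zT uT.
have z0 : 0 < rho z by [].
have u0 : 0 < rho u by [].
set A := 4 * cabs (rho2 z u).
have A0 : 0 < A by rewrite mulr_gt0// cabs_rho2_gt0.
have sA0 : 0 < Num.sqrt A by rewrite sqrtr_gt0.
pose B := Num.sqrt A `^ (- 1 - 2 * e).
have hB (x : R) : x ^+ 2 <= A -> B <= even_two_powers (2 * e) (Num.sqrt (rho z)) x.
  move=> xA; apply: powR_le_even_two_powers.
  - by rewrite mulr_gt0.
  - by rewrite sqrtr_gt0.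
  - by rewrite ler_wsqrtr// rho1_le_cabs.
  - by rewrite -sqrtr_sqr ler_wsqrtr.
have hP (F : nat -> R) : (forall j : 'I_m, (F j) ^+ 2 <= A) ->
    B ^+ m <= \prod_(j < m) even_two_powers (2 * e) (Num.sqrt (rho z)) (F j).
  move=> FA; rewrite -prodr_const_nat; apply: ler_prod => j _.
  by rewrite powR_ge0/=; exact: hB.
(* Bookkeeping of exponents: 2m (1/2 + e) for x' and y', 1 + e for 2 Im rho(z,u) and s + 1 + e for
   rho(u) add up to m + 2 + s + 2(m+1)e. *)
have -> : rho u `^ s * A `^ (- (m.+2%:R + s + 2 * m.+1%:R * e)) =
    (B ^+ m * A `^ (- 1 - e)) * (B ^+ m * (rho u `^ s * A `^ (- s - 1 - e))).
  have BE : B ^+ m = A `^ (2^-1 * (- 1 - 2 * e) * m%:R).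
    by rewrite /B -powR12_sqrt ?ltW// -powRrM -powR_mulrn ?powR_ge0// -powRrM.
  have mulE (a b c d : R) : a * b * (a * (c * d)) = c * (a * b * (a * d)) by ring.
  rewrite mulE BE; congr (_ * _).
  rewrite -!powRD; try by rewrite (gt_eqF A0) implybT.
  congr (_ `^ _); rewrite -addn2 natrD -addn1 natrD; by field.
apply: ler_pM.
- by rewrite mulr_ge0 ?exprn_ge0 ?powR_ge0.
- by rewrite !mulr_ge0 ?exprn_ge0 ?powR_ge0.
- apply: ler_pM; rewrite ?exprn_ge0 ?powR_ge0//.
  + apply: (hP (fun j => nth 0 u.1 j - nth 0 z.1 j)) => j.
    rewrite -sqrrN opprB (le_trans _ (sqr_le_cabs j zT uT))// lerDl sqr_ge0//.
  + by apply: powR_le_even_two_powers => //; [exact: rho1_le_cabs|exact: shear_le_cabs].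
- apply: ler_pM; rewrite ?mulr_ge0 ?exprn_ge0 ?powR_ge0//.
  + apply: (hP (fun j => nth 0 u.2 j - nth 0 z.2 j)) => j.
    rewrite -sqrrN opprB (le_trans _ (sqr_le_cabs j zT uT))// lerDr sqr_ge0//.
  + by apply: powR_le_two_powers => //; [exact: ltW|exact: rho1_le_cabs|exact: rho2_le_cabs].
Qed.

End KernelSize.

(** * Hoelder's inequality with an extended-valued factor *)

Section Hoelder.
Local Open Scope ereal_scope.
Context d (T : measurableType d) (R : realType) (mu : {measure set T -> \bar R}).

(** In the second variable Hoelder is applied to a power of an inner integral, which may be infinite
    at some points. If F^p has infinite integral the right side is infinite because B > 0; otherwise
    F is finite almost everywhere and is replaced by its real part [fine]. *)
Lemma ge0_hoelderT (g : T -> R) (F : T -> \bar R) (p q B : R) :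
  (0 < p)%R -> (0 < q)%R -> (p^-1 + q^-1 = 1)%R -> (0 < B)%R ->
  measurable_fun setT g -> (forall x, (0 <= g x)%R) ->
  measurable_fun setT F -> (forall x, 0 <= F x) ->
  \int[mu]_x (g x `^ q)%:E <= (B `^ q)%:E ->
  \int[mu]_x ((g x)%:E * F x) <= B%:E * (\int[mu]_x (F x `^ p)) `^ p^-1.
Proof.
move=> p0 q0 pq B0 mg g0 mF F0 gB.
have mFp : measurable_fun setT (fun x => F x `^ p).
  exact: (measurableT_comp (measurable_poweR p) mF).
have Fp0 x : 0 <= F x `^ p by exact: poweR_ge0.
have [Foo|] := ltP (\int[mu]_x (F x `^ p)) +oo; last first.
  rewrite leye_eq => /eqP ->.
  by rewrite poweRyr ?invr_eq0 ?gt_eqF// gt0_muley ?lte_fin// leey.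
pose f (x : T) : R := fine (F x).
have mf : measurable_fun setT f by exact: (measurableT_comp (@fine_measurable R setT measurableT) mF).
have f0 x : (0 <= f x)%R by exact: fine_ge0.
have intF : mu.-integrable setT (fun x => F x `^ p).
  by apply/integrableP; split => //; under eq_integral do rewrite gee0_abs//.
have aef : ae_eq mu setT F (EFin \o f).
  apply: filterS (integrable_ae measurableT intF) => x /(_ Logic.I) h _.
  rewrite /= /f fineK// ge0_fin_numE//.
  by apply: (@lty_poweRy _ _ p); rewrite ?gt_eqF// ltey_eq h.
rewrite (ge0_ae_eq_integral (g := fun x => (g x)%:E * (f x)%:E))//; last 5 first.
- by apply: emeasurable_funM => //; exact/measurable_EFinP.
- by apply: emeasurable_funM => //; exact/measurable_EFinP.
- by move=> x _; rewrite mule_ge0// lee_fin.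
- by move=> x _; rewrite mule_ge0// lee_fin.
- by apply: ae_eqe_mul2l.
have hE := hoelder mu mg mf q0 p0.
rewrite addrC in hE; have {hE} := hE pq.
rewrite Lnorm1 !Lnorm.unlock /=.
under eq_integral do rewrite /= normrM !ger0_norm// EFinM.
move=> /le_trans; apply; apply: lee_pmul; rewrite ?poweR_ge0//.
- under eq_integral do rewrite /= ger0_norm//.
  have -> : B%:E = (B `^ q)%:E `^ q^-1.
    by rewrite poweR_EFin -powRrM mulfV ?gt_eqF// powRr1// ltW.
  apply: gt0_ler_poweR => //.
  + by rewrite invr_ge0 ltW.
  + by rewrite in_itv/= leey andbT; apply: integral_ge0 => x _; rewrite lee_fin powR_ge0.
  + by rewrite in_itv/= leey andbT lee_fin powR_ge0.
- rewrite (ge0_ae_eq_integral (f := fun x => F x `^ p)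
    (g := fun x => (`|f x| `^ p)%:E))//.
  + apply/measurable_EFinP.
    apply: (@measurableT_comp _ _ _ _ _ _ (fun y : R => y `^ p)%R _ (fun x => `|f x|%R)).
      exact: measurable_powR.
    exact: measurableT_comp.
  + apply: filterS aef => x /(_ Logic.I) -> _ /=.
    by rewrite ger0_norm.
Qed.

(** Extension by zero outside [D] commutes with positive powers, which reduces this to the whole
    space. *)
Lemma ge0_hoelder (D : set T) (g : T -> R) (F : T -> \bar R) (p q B : R) :
  measurable D ->
  (0 < p)%R -> (0 < q)%R -> (p^-1 + q^-1 = 1)%R -> (0 < B)%R ->
  measurable_fun D g -> (forall x, D x -> (0 <= g x)%R) ->
  measurable_fun D F -> (forall x, D x -> 0 <= F x) ->
  \int[mu]_(x in D) (g x `^ q)%:E <= (B `^ q)%:E ->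
  \int[mu]_(x in D) ((g x)%:E * F x) <=
    B%:E * (\int[mu]_(x in D) (F x `^ p)) `^ p^-1.
Proof.
move=> mD p0 q0 pq B0 mg g0 mF F0 gB.
have := @ge0_hoelderT (g \_ D) (F \_ D) p q B p0 q0 pq B0.
rewrite (_ : (fun x => ((g \_ D) x)%:E * (F \_ D) x) = (fun x => (g x)%:E * F x) \_ D); last first.
  by apply/funext => x; rewrite /patch; case: ifP; rewrite ?mul0e.
rewrite (_ : (fun x => (F \_ D) x `^ p) = (fun x => F x `^ p) \_ D); last first.
  by apply/funext => x; rewrite /patch; case: ifP => // _; rewrite poweR0r ?gt_eqF.
rewrite (_ : (fun x => ((g \_ D) x `^ q)%:E) = (fun x => (g x `^ q)%:E) \_ D); last first.
  by apply/funext => x; rewrite /patch; case: ifP => // _; rewrite powR0 ?gt_eqF.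
rewrite -!integral_mkcond; apply => //.
- exact/(measurable_restrictT _ _).1.
- by move=> x; rewrite /patch; case: ifPn => // /set_mem; exact: g0.
- exact/(measurable_restrictT _ _).1.
- by move=> x; rewrite /patch; case: ifPn => // /set_mem; exact: F0.
Qed.

End Hoelder.

(** * The integrated Forelli-Rudin estimate *)

Section ForelliRudin.
Context (R : realType) (m : nat).
Notation C := (Cn R m.+1).

Lemma integral_shift_fine (f : R -> R) (a : R) (B : R) :
  measurable_fun setT f -> (forall x, 0 <= f x) ->
  (\int[@lebesgue_measure R]_x (f x)%:E <= B%:E)%E ->
  (\int[@lebesgue_measure R]_x (f ((x : R) - a)%R)%:E =
    (fine (\int[@lebesgue_measure R]_x (f x)%:E))%:E)%E.
Proof.
move=> mf f0 fB.
rewrite (@ge0_integral_lebesgue_shift R a (EFin \o f)); last 2 first.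
- exact/measurable_EFinP.
- by move=> x; rewrite lee_fin.
rewrite fineK// ge0_fin_numE; first exact: le_lt_trans fB (ltry _).
by apply: integral_ge0 => x _; rewrite lee_fin.
Qed.

(** Here t = 2(m+1)e. With r = rho(z), each of the 2m + 2 one-dimensional integrals of the majorant
    is at most a constant times r^(-e); for the coordinates of x' and y' this is (sqrt r)^(-2e).
    Their product is of order r^(-t), and the factor 4^c pays for the 4 in 4 |rho(z,u)|. *)
Lemma forelli_rudin (s e : R) : -1 < s -> 0 < e ->
  exists2 A : R, 0 < A & forall z : C, TB z ->
  (\int[@volC R m.+1]_(u in @TB R m.+1)
    (rho u `^ s * cabs (rho2 z u) `^ (- (m.+2%:R + s + 2 * m.+1%:R * e)))%:E
   <= (A * rho z `^ (- (2 * m.+1%:R * e)))%:E)%E.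
Proof.
move=> s1 e0; set c := _ + _ + _.
have s10 : 0 < s + 1 by lra.
have e20 : 0 < 2 * e by rewrite mulr_gt0.
pose k1 := 2 * (1 + (2 * e)^-1); pose k2 := 2 * (1 + e^-1); pose k3 := (s + 1)^-1 + e^-1.
have k10 : 0 < k1 by rewrite mulr_gt0// addr_gt0// invr_gt0.
have k20 : 0 < k2 by rewrite mulr_gt0// addr_gt0// invr_gt0.
have k30 : 0 < k3 by rewrite addr_gt0// invr_gt0.
exists (4 `^ c * (k1 ^+ m * k2 * (k1 ^+ m * k3))).
  have P := exprn_gt0 m k10.
  have P2 : 0 < k1 ^+ m * k2 by apply: mulr_gt0.
  have P3 : 0 < k1 ^+ m * k3 by apply: mulr_gt0.
  have P4 : 0 < 4 `^ c by apply: powR_gt0; exact: ltr0n.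
  by apply: mulr_gt0 => //; apply: mulr_gt0.
move=> z zT; have z0 : 0 < rho z by [].
set r := rho z; have sr0 : 0 < Num.sqrt r by rewrite sqrtr_gt0.
pose E1 := even_two_powers (2 * e) (Num.sqrt r).
pose E2 := even_two_powers e r.
pose E3 := two_powers s e r.
pose I1 := fine (\int[@lebesgue_measure R]_x (E1 x)%:E)%E.
pose I2 := fine (\int[@lebesgue_measure R]_x (E2 x)%:E)%E.
pose I3 := fine (\int[@lebesgue_measure R]_x (E3 x)%:E)%E.
have h1 := integral_even_two_powers e20 sr0.
have h2 := integral_even_two_powers e0 z0.
have h3 := integral_two_powers s1 e0 z0.
have mE1 : measurable_fun setT E1 by exact: measurable_even_two_powers.
have mE2 : measurable_fun setT E2 by exact: measurable_even_two_powers.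
have mE3 : measurable_fun setT E3 by exact: measurable_two_powers.
have E10 x : 0 <= E1 x by exact: even_two_powers_ge0.
have E20 x : 0 <= E2 x by exact: even_two_powers_ge0.
have E30 x : 0 <= E3 x by exact: two_powers_ge0.
have fineB (f : R -> R) (B : R) : (forall x, 0 <= f x) ->
    (\int[@lebesgue_measure R]_x (f x)%:E <= B%:E)%E ->
    0 <= fine (\int[@lebesgue_measure R]_x (f x)%:E) <= B.
  move=> f0 fB.
  have i0 : (0 <= \int[@lebesgue_measure R]_x (f x)%:E)%E.
    by apply: integral_ge0 => x _; rewrite lee_fin.
  rewrite fine_ge0//= -lee_fin fineK// ge0_fin_numE//.
  exact: le_lt_trans fB (ltry _).
have rr : Num.sqrt r `^ (- (2 * e)) = r `^ (- e).
  by rewrite -powR12_sqrt ?ltW// -powRrM; congr (_ `^ _); field.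
have /andP[I10 I1B] : 0 <= I1 <= k1 * r `^ (- e) by rewrite -rr; exact: fineB.
have /andP[I20 I2B] : 0 <= I2 <= k2 * r `^ (- e) by exact: fineB.
have /andP[I30 I3B] : 0 <= I3 <= k3 * r `^ (- e) by exact: fineB.
pose Phi (v : m.+1.-tuple R) (xi : seq R) := nth 0 z.1 m - \sum_(j < m)
     (nth 0 z.1 j - nth 0 xi j) * (nth 0 z.2 j + nth 0 v j).
pose G (u : C) :=
  (\prod_(j < m) E1 (nth 0 u.1 j - nth 0 z.1 j) * E2 (nth 0 u.1 m - Phi u.2 (take m u.1))) *
  (\prod_(j < m) E1 (nth 0 u.2 j - nth 0 z.2 j) * E3 (rho u)).
have mPhi : measurable_fun setT (fun u : C => Phi u.2 (take m u.1)).
  rewrite /Phi; under eq_fun do under eq_bigr do rewrite nth_take//.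
  apply: measurable_funB => //; apply: measurable_sum => j; apply: measurable_funM.
    by apply: measurable_funB => //; exact: measurable_nth1.
  by apply: measurable_funD => //; exact: measurable_nth2.
have mG : measurable_fun setT G.
  apply: measurable_funM; apply: measurable_funM.
  - apply: measurable_prod => j _; apply: measurableT_comp => //.
    by apply: measurable_funB => //; exact: measurable_nth1.
  - apply: measurableT_comp => //; apply: measurable_funB => //.
    exact: measurable_nth1.
  - apply: measurable_prod => j _; apply: measurableT_comp => //.
    by apply: measurable_funB => //; exact: measurable_nth2.
  - by apply: measurableT_comp => //; exact: measurable_rho.
have G0 u : 0 <= G u by rewrite !mulr_ge0// prodr_ge0.
have intG : (\int[@volC R m.+1]_u (G u)%:E =
    ((\prod_(j < m) I1 * I2) * (\prod_(j < m) I1 * I3))%:E)%E.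
  apply: (@ge0_integral_volC_shear R m (fun j x => E1 (x - nth 0 z.1 j)) E2
    (fun j x => E1 (x - nth 0 z.2 j)) E3 Phi (fun=> I1) (fun=> I1) I2 I3) => //.
  - by move=> j; apply: measurableT_comp => //; exact: measurable_funB.
  - by move=> j; apply: measurableT_comp => //; exact: measurable_funB.
  - by move=> j; exact: (integral_shift_fine _ mE1 E10 h1).
  - rewrite fineK// ge0_fin_numE; first exact: le_lt_trans h2 (ltry _).
    by apply: integral_ge0 => x _; rewrite lee_fin.
  - by move=> j; exact: (integral_shift_fine _ mE1 E10 h1).
  - rewrite fineK// ge0_fin_numE; first exact: le_lt_trans h3 (ltry _).
    by apply: integral_ge0 => x _; rewrite lee_fin.
apply: (@le_trans _ _ (\int[@volC R m.+1]_u ((4 `^ c)%:E * (G u)%:E))%E).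
  rewrite integral_mkcond; apply: ge0_le_integral => //.
  - by move=> u _; rewrite /patch; case: ifP => // _; rewrite lee_fin mulr_ge0 ?powR_ge0.
  - apply/(measurable_restrictT _ _).1; first exact: measurable_TB.
    apply: measurable_funTS; apply/measurable_EFinP; apply: measurable_funM.
      by exact: (measurableT_comp (measurable_powR _) (@measurable_rho R m)).
    by exact: (measurableT_comp (measurable_powR _) (measurable_cabs_rho2 _)).
  - by apply: emeasurable_funM => //; exact/measurable_EFinP.
  - move=> u _; rewrite /patch; case: ifPn => [/set_mem uT|_]; last first.
      by rewrite -EFinM lee_fin mulr_ge0 ?powR_ge0.
    rewrite -EFinM lee_fin.
    have := forelli_rudin_pointwise s1 e0 zT uT; rewrite -/c.
    rewrite powRM ?cabs_ge0// mulrCA powRN => h.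
    rewrite -ler_pdivrMl ?powR_gt0//; apply: le_trans h _.
    rewrite /G /Phi /E1 /E2 /E3 le_eqVlt; apply/orP; left; apply/eqP.
    congr (_ * _ * _); congr (even_two_powers _ _ (_ - (_ - _))).
    by apply: eq_bigr => j _; rewrite nth_take.
rewrite ge0_integralZl//; last 2 first.
- exact/measurable_EFinP.
- by move=> u _; rewrite lee_fin.
rewrite intG -EFinM lee_fin -[leRHS]mulrA ler_pM2l ?powR_gt0// !prodr_const card_ord.
have -> : r `^ (- (2 * m.+1%:R * e)) =
    ((r `^ (- e)) ^+ m * r `^ (- e)) * ((r `^ (- e)) ^+ m * r `^ (- e)).
  rewrite -exprSr -expr2 -exprM -powR_mulrn ?powR_ge0// -powRrM.
  by congr (_ `^ _); rewrite natrM; ring.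
apply: (@le_trans _ _ (((k1 * r `^ (- e)) ^+ m * (k2 * r `^ (- e))) *
                       ((k1 * r `^ (- e)) ^+ m * (k3 * r `^ (- e))))); last first.
  by rewrite !exprMn; rewrite le_eqVlt; apply/orP; left; apply/eqP; ring.
have pe0 : 0 <= k1 * r `^ (- e) by rewrite mulr_ge0 ?powR_ge0 ?ltW.
apply: ler_pM; rewrite ?mulr_ge0 ?exprn_ge0//; apply: ler_pM; rewrite ?exprn_ge0//.
- by apply: lerXn2r.
- by apply: lerXn2r.
Qed.

End ForelliRudin.

(** * Sufficiency *)

Section Sufficiency.
Context (R : realType) (m : nat).
Notation C := (Cn R m.+1).
Notation T := (@TB R m.+1).
Notation vol := (@volC R m.+1).

Lemma measurable_powR_rho (s : R) : measurable_fun setT (fun u : C => rho u `^ s).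
Proof. exact: (measurableT_comp (measurable_powR s) (@measurable_rho R m)). Qed.

Lemma measurable_powR_cabs_rho2 (s : R) (z : C) :
  measurable_fun setT (fun u : C => cabs (rho2 z u) `^ s).
Proof. exact: (measurableT_comp (measurable_powR s) (measurable_cabs_rho2 z)). Qed.

(** Split rho^b as rho^(b - al/p) rho^(al/p), so that the second factor carries the weight of the
    norm. With q conjugate to p, the q-th power of the rest is a Forelli-Rudin integrand with s = (b
    - al/p) q and t = a q: the condition on b says s > -1, the condition a > 0 says t > 0, and the
    formula for c says c q = m + 2 + s + t. The q-th root of rho(z)^(-t) is rho(z)^(-a). *)
Lemma hoelder_kernel (a b c p al : R) : 1 < p -> 0 < a -> al + 1 < p * (b + 1) ->
  c = m.+2%:R + a + b - (m.+2%:R + al) / p ->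
  exists2 A : R, 0 < A & forall (z : C) (F : C -> \bar R), T z ->
    measurable_fun setT F -> (forall u, 0 <= F u)%E ->
    (\int[vol]_(u in T) ((rho u `^ b * cabs (rho2 z u) `^ (- c))%:E * F u) <=
     (A * rho z `^ (- a))%:E *
     (\int[vol]_(u in T) (F u `^ p * (rho u `^ al)%:E)) `^ p^-1)%E.
Proof.
move=> p1 a0 bal cE.
have p0 : 0 < p by lra.
have pm0 : 0 < p - 1 by lra.
pose q := p / (p - 1).
have q0 : 0 < q by rewrite divr_gt0.
have pq : p^-1 + q^-1 = 1 by rewrite /q; field; rewrite !gt_eqF.
pose s := (b - al / p) * q.
have sE : s = (b * p - al) / (p - 1) by rewrite /s /q; field; rewrite !gt_eqF.
have s1 : -1 < s.
  rewrite sE ltr_pdivlMr//; lra.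
(* Solves 2(m+1)e = a q, the exponent t of the estimate. *)
pose e := a * q / (2 * m.+1%:R).
have m10 : 0 < m.+1%:R :> R by rewrite ltr0n.
have e0 : 0 < e by rewrite !(divr_gt0, mulr_gt0).
have eE : 2 * m.+1%:R * e = a * q by rewrite /e; field; rewrite gt_eqF.
have [A0 A00 FR] := @forelli_rudin R m s e s1 e0.
exists (A0 `^ q^-1); first exact: powR_gt0.
move=> z F zT mF F0.
have cq : c * q = m.+2%:R + s + a * q.
  by rewrite cE /s /q; field; rewrite !gt_eqF.
have z0 : 0 < rho z by [].
have mr t : measurable_fun T (fun u : C => rho u `^ t).
  by apply: measurable_funTS; exact: measurable_powR_rho.
have mc t : measurable_fun T (fun u : C => cabs (rho2 z u) `^ t).
  by apply: measurable_funTS; exact: measurable_powR_cabs_rho2.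
have mFT : measurable_fun T F by exact: measurable_funTS.
pose g (u : C) := rho u `^ (b - al / p) * cabs (rho2 z u) `^ (- c).
pose H (u : C) := (F u * (rho u `^ (al / p))%:E)%E.
pose B := A0 `^ q^-1 * rho z `^ (- a).
have B0 : 0 < B by rewrite mulr_gt0 ?powR_gt0.
have mg : measurable_fun T g by exact: measurable_funM.
have g0 u : T u -> 0 <= g u by move=> _; rewrite mulr_ge0 ?powR_ge0.
have mH : measurable_fun T H by apply: emeasurable_funM => //; exact/measurable_EFinP.
have H0 u : T u -> (0 <= H u)%E by move=> _; rewrite mule_ge0// lee_fin powR_ge0.
have gB : (\int[vol]_(u in T) (g u `^ q)%:E <= (B `^ q)%:E)%E.
  rewrite /B powRM ?powR_ge0// -!powRrM mulVf ?gt_eqF// powRr1 ?(ltW A00)//.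
  rewrite (eq_integral (fun u => (rho u `^ s *
      cabs (rho2 z u) `^ (- (m.+2%:R + s + 2 * m.+1%:R * e)))%:E)); last first.
    by move=> u _; rewrite powRM ?powR_ge0// -!powRrM eE -cq mulNr.
  by rewrite mulNr -eE; exact: FR.
have := ge0_hoelder (@measurable_TB R m) p0 q0 pq B0 mg g0 mH H0 gB.
rewrite (eq_integral (fun u => (rho u `^ b * cabs (rho2 z u) `^ (- c))%:E * F u)%E); last first.
  move=> u /set_mem uT; have u0 : 0 < rho u by [].
  rewrite /H /g muleCA -EFinM mulrAC -powRD; last by rewrite (gt_eqF u0) implybT.
  by rewrite subrK muleC.
rewrite [X in (_ <= _ * X `^ _)%E -> _](eq_integral
    (fun u => F u `^ p * (rho u `^ al)%:E)%E)//.
move=> u /set_mem uT; rewrite /H poweRM ?lee_fin ?powR_ge0// poweR_EFin -powRrM.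
by rewrite divfK// gt_eqF.
Qed.

Lemma ge0_integral_volCC (F : C * C -> \bar R) :
  measurable_fun setT F -> (forall q, 0 <= F q)%E ->
  (\int[@volCC R m.+1]_(q in T `*` T) F q =
   \int[vol]_(w in T) \int[vol]_(z in T) F (z, w))%E.
Proof.
move=> mF F0; rewrite integral_mkcond.
have mTT : measurable (T `*` T) by apply: measurableX; exact: measurable_TB.
rewrite (fubini_tonelli2 (m1 := vol) (m2 := vol)); last 2 first.
- by apply/(measurable_restrictT _ _).1 => //; exact: measurable_funTS.
- by move=> q; rewrite /patch; case: ifP.
rewrite [RHS]integral_mkcond; apply: eq_integral => w _; rewrite /fubini_G /patch.
case: ifPn => [/set_mem wT|/negP wT].
  rewrite [RHS]integral_mkcond; apply: eq_integral => z _; rewrite /patch.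
  congr (if _ then _ else _); apply/idP/idP => /set_mem h; apply/mem_set.
    by case: h.
  by split.
rewrite integral0_eq// => z _; rewrite ifF//; apply/negP => /set_mem[_ /= h].
by apply: wT; apply/mem_set.
Qed.

Lemma measurable_integral_section (F : C * C -> \bar R) :
  measurable_fun setT F -> (forall q, 0 <= F q)%E ->
  measurable_fun setT (fun w : C => \int[vol]_(z in T) F (z, w))%E.
Proof.
move=> mF F0.
rewrite (_ : (fun w : C => _) = fubini_G vol (fun q : C * C =>
    ((fun z : C => F (z, q.2)) \_ T) q.1)); last first.
  by apply/funext => w; rewrite integral_mkcond.
apply: measurable_fun_fubini_tonelli_G; last by move=> q; rewrite /patch; case: ifP.
rewrite (_ : (fun q : C * C => _) = F \_ (T `*` setT)); last first.
  apply/funext => -[z w]; rewrite /patch /=; congr (if _ then _ else _).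
  apply/idP/idP => /set_mem h; apply/mem_set; first by split.
  by case: h.
apply/(measurable_restrictT _ _).1; first by apply: measurableX => //; exact: measurable_TB.
exact: measurable_funTS.
Qed.

Lemma cabsM (v w : R[i]) : cabs (v * w) = cabs v * cabs w.
Proof.
case: v => a b; case: w => c d; rewrite /cabs /cre /cim /= -sqrtrM; last first.
  by rewrite addr_ge0 ?sqr_ge0.
by congr Num.sqrt; ring.
Qed.

Lemma measurable_creM d (X : measurableType d) (f g : X -> R[i]) :
  measurable_fun setT (fun x => cre (f x)) -> measurable_fun setT (fun x => cim (f x)) ->
  measurable_fun setT (fun x => cre (g x)) -> measurable_fun setT (fun x => cim (g x)) ->
  measurable_fun setT (fun x => cre (f x * g x)) /\
  measurable_fun setT (fun x => cim (f x * g x)).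
Proof.
move=> fr fi gr gi; split.
  rewrite (_ : (fun x => _) = (fun x => cre (f x) * cre (g x) - cim (f x) * cim (g x))).
    by apply: measurable_funB; apply: measurable_funM.
  by apply/funext => x; case: (f x) => ? ?; case: (g x).
rewrite (_ : (fun x => _) = (fun x => cre (f x) * cim (g x) + cim (f x) * cre (g x))).
  by apply: measurable_funD; apply: measurable_funM.
by apply/funext => x; case: (f x) => ? ?; case: (g x).
Qed.

(** The common modulus of [kerS] and [kerT], arranged as a factor in (z,u) times a factor in
    (w,eta). *)
Definition kerabs (b1 b2 c1 c2 : R) (z w u eta : C) : R :=
  (rho u `^ b1 * cabs (rho2 z u) `^ (- c1)) *
  (rho eta `^ b2 * cabs (rho2 w eta) `^ (- c2)).

Lemma kerabs_ge0 b1 b2 c1 c2 z w u eta : 0 <= kerabs b1 b2 c1 c2 z w u eta.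
Proof. by rewrite !mulr_ge0 ?powR_ge0. Qed.

Lemma measurable_kerabs b1 b2 c1 c2 z w :
  measurable_fun setT (fun q : C * C => kerabs b1 b2 c1 c2 z w q.1 q.2).
Proof.
apply: measurable_funM.
  apply: (measurableT_comp (f := fun u : C => rho u `^ b1 * cabs (rho2 z u) `^ (- c1))) => //.
  by apply: measurable_funM; [exact: measurable_powR_rho|exact: measurable_powR_cabs_rho2].
apply: (measurableT_comp (f := fun u : C => rho u `^ b2 * cabs (rho2 w u) `^ (- c2))) => //.
by apply: measurable_funM; [exact: measurable_powR_rho|exact: measurable_powR_cabs_rho2].
Qed.

(** Hoelder in u at fixed eta produces G(eta)^(1/p1), and Hoelder in eta is then applied to this
    function: its p2-th power G^(p2/p1) is exactly what [mixnorm] integrates. The order of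
    integration is that of the norm, so p1 and p2 may come in either order of size. *)
Lemma integral_kerabs_le (p1 p2 a1 a2 b1 b2 c1 c2 al1 al2 : R) :
  1 < p1 -> 1 < p2 ->
  [/\ 0 < a1, al1 + 1 < p1 * (b1 + 1) & c1 = m.+2%:R + a1 + b1 - (m.+2%:R + al1) / p1] ->
  [/\ 0 < a2, al2 + 1 < p2 * (b2 + 1) & c2 = m.+2%:R + a2 + b2 - (m.+2%:R + al2) / p2] ->
  exists2 A : R, 0 < A & forall (z w : C) (f : C * C -> R[i]), T z -> T w ->
    measurable_fun setT (fun q => cre (f q)) -> measurable_fun setT (fun q => cim (f q)) ->
    (\int[@volCC R m.+1]_(q in T `*` T) (kerabs b1 b2 c1 c2 z w q.1 q.2 * cabs (f q))%:E
     <= (A * rho z `^ (- a1) * rho w `^ (- a2))%:E * mixnorm p1 p2 al1 al2 f)%E.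
Proof.
move=> p11 p21 [a10 bal1 c1E] [a20 bal2 c2E].
have [A1 A10 H1] := hoelder_kernel p11 a10 bal1 c1E.
have [A2 A20 H2] := hoelder_kernel p21 a20 bal2 c2E.
exists (A1 * A2); first exact: mulr_gt0.
move=> z w f zT wT mfr mfi.
have mf := measurable_cabs mfr mfi.
rewrite ge0_integral_volCC; last 2 first.
- by apply/measurable_EFinP; apply: measurable_funM => //; exact: measurable_kerabs.
- by move=> q; rewrite lee_fin mulr_ge0 ?kerabs_ge0 ?cabs_ge0.
pose G (eta : C) := (\int[vol]_(u in T) ((cabs (f (u, eta)) `^ p1 * rho u `^ al1)%:E))%E.
have mG : measurable_fun setT G.
  apply: (measurable_integral_section
    (F := fun q : C * C => (cabs (f q) `^ p1 * rho q.1 `^ al1)%:E)).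
    apply/measurable_EFinP; apply: measurable_funM.
      exact: (measurableT_comp (measurable_powR p1) mf).
    exact: (measurableT_comp (measurable_powR_rho al1) measurable_fst).
  by move=> q; rewrite lee_fin mulr_ge0 ?powR_ge0.
have G0 eta : (0 <= G eta)%E.
  by apply: integral_ge0 => u _; rewrite lee_fin mulr_ge0 ?powR_ge0.
have mGp : measurable_fun setT (fun eta => G eta `^ p1^-1)%E.
  exact: (measurableT_comp (measurable_poweR p1^-1) mG).
have mh2 : measurable_fun setT (fun u : C => rho u `^ b2 * cabs (rho2 w u) `^ (- c2)).
  by apply: measurable_funM; [exact: measurable_powR_rho|exact: measurable_powR_cabs_rho2].
apply: (@le_trans _ _ (\int[vol]_(eta in T) ((A1 * rho z `^ (- a1))%:E *
    ((rho eta `^ b2 * cabs (rho2 w eta) `^ (- c2))%:E * (G eta `^ p1^-1))))%E).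
  apply: ge0_le_integral.
  - exact: measurable_TB.
  - move=> eta _; apply: integral_ge0 => u _.
    by rewrite lee_fin mulr_ge0 ?kerabs_ge0 ?cabs_ge0.
  - apply: measurable_funTS.
    apply: (measurable_integral_section (F := fun q : C * C =>
        (kerabs b1 b2 c1 c2 z w q.1 q.2 * cabs (f q))%:E)).
      apply/measurable_EFinP; apply: measurable_funM => //.
      exact: measurable_kerabs.
    by move=> q; rewrite lee_fin mulr_ge0 ?kerabs_ge0 ?cabs_ge0.
  - apply: measurable_funTS; apply: emeasurable_funM => //.
    by apply: emeasurable_funM => //; exact/measurable_EFinP.
  move=> eta etaT; rewrite muleCA.
  have mfe : measurable_fun setT (fun u => (cabs (f (u, eta)))%:E).
    apply/measurable_EFinP; exact: (measurableT_comp mf (pair2_measurable eta)).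
  under eq_integral => u _.
    rewrite /kerabs /= [X in X * _]mulrC -mulrA EFinM [X in (_ * X)%E]EFinM.
    over.
  rewrite ge0_integralZl//; last 4 first.
  - exact: measurable_TB.
  - apply: measurable_funTS; apply: emeasurable_funM => //.
    apply/measurable_EFinP.
    by apply: measurable_funM; [exact: measurable_powR_rho|exact: measurable_powR_cabs_rho2].
  - by move=> u _; rewrite mule_ge0// lee_fin ?cabs_ge0 ?mulr_ge0 ?powR_ge0.
  - by rewrite lee_fin mulr_ge0 ?powR_ge0.
  apply: lee_pmul => //.
  - by rewrite lee_fin mulr_ge0 ?powR_ge0.
  - by apply: integral_ge0 => u _; rewrite mule_ge0// lee_fin ?cabs_ge0 ?mulr_ge0 ?powR_ge0.
  apply: le_trans (H1 z (fun u => (cabs (f (u, eta)))%:E) zT mfe _) _.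
    by move=> u; rewrite lee_fin cabs_ge0.
  by under eq_integral do rewrite poweR_EFin -EFinM.
rewrite ge0_integralZl//; last 4 first.
- exact: measurable_TB.
- apply: measurable_funTS; apply: emeasurable_funM => //.
  exact/measurable_EFinP.
- by move=> u _; rewrite mule_ge0// ?poweR_ge0// lee_fin mulr_ge0 ?powR_ge0.
- by rewrite lee_fin mulr_ge0 ?powR_ge0// ltW.
have h := H2 w (fun eta => G eta `^ p1^-1)%E wT mGp (fun _ => poweR_ge0 _ _).
apply: (@le_trans _ _ ((A1 * rho z `^ (- a1))%:E * ((A2 * rho w `^ (- a2))%:E *
    mixnorm p1 p2 al1 al2 f))%E).
  apply: lee_pmul => //.
  - by rewrite lee_fin mulr_ge0 ?powR_ge0// ltW.
  - apply: integral_ge0 => u _.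
    by rewrite mule_ge0// ?poweR_ge0// lee_fin mulr_ge0 ?powR_ge0.
  - apply: le_trans h _; rewrite /mixnorm.
    under eq_integral do rewrite -poweRrM mulrC.
    by [].
by rewrite muleA -EFinM mulrACA [X in (X%:E * _)%E]mulrA.
Qed.

(** The estimate holds at every point of the domain, so the exceptional set is empty; the factors
    rho^a in front of the integral cancel the rho^(-a) of the bound. *)
Lemma bounded_of_kerabs (K : C -> C -> C -> C -> R[i])
    (p1 p2 a1 a2 b1 b2 c1 c2 al1 al2 : R) :
  (forall z w, measurable_fun setT (fun q => cre (K z w q.1 q.2))) ->
  (forall z w, measurable_fun setT (fun q => cim (K z w q.1 q.2))) ->
  (forall z w u eta, T z -> T w -> T u -> T eta ->
    cabs (K z w u eta) <= kerabs b1 b2 c1 c2 z w u eta) ->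
  1 < p1 -> 1 < p2 ->
  [/\ 0 < a1, al1 + 1 < p1 * (b1 + 1) & c1 = m.+2%:R + a1 + b1 - (m.+2%:R + al1) / p1] ->
  [/\ 0 < a2, al2 + 1 < p2 * (b2 + 1) & c2 = m.+2%:R + a2 + b2 - (m.+2%:R + al2) / p2] ->
  bounded_Lp_Linf K a1 a2 p1 p2 al1 al2.
Proof.
move=> mKr mKi Kle p11 p21 h1 h2.
have [A A0 HA] := integral_kerabs_le p11 p21 h1 h2.
(* The factor 2 arises because real and imaginary parts are estimated separately. *)
exists (2 * A) => f [mfr [mfi fin]].
exists set0; split; first exact: negligible_set0.
move=> [z w] [/= zT wT] _.
have mix0 : (0 <= mixnorm p1 p2 al1 al2 f)%E by exact: poweR_ge0.
have mixE : mixnorm p1 p2 al1 al2 f = (fine (mixnorm p1 p2 al1 al2 f))%:E.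
  by rewrite fineK// ge0_fin_numE.
have mTT : measurable (T `*` T) by apply: measurableX; exact: measurable_TB.
have [mIr mIi] := measurable_creM (mKr z w) (mKi z w) mfr mfi.
pose B := A * rho z `^ (- a1) * rho w `^ (- a2) * fine (mixnorm p1 p2 al1 al2 f).
have bound (g : C * C -> R) : measurable_fun setT g ->
    (forall q, (T `*` T) q -> `|g q| <= cabs (integrand K f z w q)) ->
    (\int[@volCC R m.+1]_(q in T `*` T) `|(g q)%:E| <= B%:E)%E.
  move=> mg gle.
  apply: le_trans (_ : (\int[@volCC R m.+1]_(q in T `*` T)
    (kerabs b1 b2 c1 c2 z w q.1 q.2 * cabs (f q))%:E <= _)%E).
    apply: ge0_le_integral => //.
    - apply: measurable_funTS; apply: measurableT_comp => //; exact/measurable_EFinP.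
    - apply: measurable_funTS; apply/measurable_EFinP; apply: measurable_funM.
        exact: measurable_kerabs.
      exact: measurable_cabs.
    - move=> [u eta] uT; rewrite lee_fin (le_trans (gle _ uT))//.
      rewrite /integrand cabsM ler_wpM2r ?cabs_ge0//.
      by case: uT => ? ?; exact: Kle.
  apply: le_trans (HA z w f zT wT mfr mfi) _.
  by rewrite mixE -EFinM.
have br := bound _ mIr (fun q _ => le_cre_cabs _).
have bi := bound _ mIi (fun q _ => le_cim_cabs _).
have intr : (@volCC R m.+1).-integrable (T `*` T)
    (fun q => (cre (integrand K f z w q))%:E).
  apply/integrableP; split; last exact: le_lt_trans br (ltry _).
  by apply: measurable_funTS; exact/measurable_EFinP.
have inti : (@volCC R m.+1).-integrable (T `*` T)
    (fun q => (cim (integrand K f z w q))%:E).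
  apply/integrableP; split; last exact: le_lt_trans bi (ltry _).
  by apply: measurable_funTS; exact/measurable_EFinP.
split; first by split.
have fineB (g : C * C -> R) : (@volCC R m.+1).-integrable (T `*` T) (EFin \o g) ->
    (\int[@volCC R m.+1]_(q in T `*` T) `|(g q)%:E| <= B%:E)%E ->
    `|fine (\int[@volCC R m.+1]_(q in T `*` T) (g q)%:E)| <= B.
  move=> ig gB; rewrite -lee_fin -abse_EFin fineK.
    by apply: le_trans gB; apply: le_abse_integral => //; exact: measurable_int ig.
  exact: integrable_fin_num.
have rB := fineB _ intr br; have iB := fineB _ inti bi.
rewrite /op_val cabsM.
have -> : cabs (Complex (rho z `^ a1 * rho w `^ a2) 0) = rho z `^ a1 * rho w `^ a2.
  rewrite /cabs /cre /cim /= expr0n addr0 sqrtr_sqr ger0_norm//.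
  by rewrite mulr_ge0 ?powR_ge0.
have r0 : 0 < rho z by []. have r0' : 0 < rho w by [].
apply: (@le_trans _ _ (rho z `^ a1 * rho w `^ a2 * (2 * B))).
  apply: ler_wpM2l; first by rewrite mulr_ge0 ?powR_ge0.
  by apply: le_trans (cabs_le_add _) _; rewrite mulr_natl mulr2n lerD.
rewrite /B !powRN; set x := rho z `^ a1; set y := rho w `^ a2.
have x0 : 0 < x by exact: powR_gt0.
have y0 : 0 < y by exact: powR_gt0.
rewrite le_eqVlt; apply/orP; left; apply/eqP; field.
by rewrite !gt_eqF.
Qed.

End Sufficiency.

(** * Polar form of the two kernels, and the region where their phase is small *)

Section Kernels.
Context (R : realType) (m : nat).
Notation C := (Cn R m.+1).
Notation T := (@TB R m.+1).

Lemma inv_cpow (w : R[i]) (c : R) : (cpow w c)^-1 =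
  Complex (cabs w `^ (- c) * cos (c * atan (cim w / cre w)))
          (- (cabs w `^ (- c) * sin (c * atan (cim w / cre w)))).
Proof.
rewrite /cpow; set t := c * _; set M := cabs w.
(* In the degenerate case both sides vanish, by the convention that the inverse of 0 is 0. *)
have [M0|M0] := eqVneq (M `^ c) 0.
  by rewrite powRN M0 invr0 !mul0r oppr0 invr0.
apply: GRing.mulr1_eq; rewrite powRN; simpc.
have h : M `^ c * cos t * ((M `^ c)^-1 * cos t) + M `^ c * sin t * ((M `^ c)^-1 * sin t) = 1.
  transitivity (M `^ c * (M `^ c)^-1 * (cos t ^+ 2 + sin t ^+ 2)); first by ring.
  by rewrite mulfV// mul1r cos2Dsin2.
congr Complex; first by rewrite -[RHS]h; ring.
by field.
Qed.

Lemma kerTE (b1 b2 c1 c2 : R) (z w u eta : C) :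
  let t := c1 * atan (cim (rho2 z u) / cre (rho2 z u)) +
           c2 * atan (cim (rho2 w eta) / cre (rho2 w eta)) in
  kerT b1 b2 c1 c2 z w u eta =
  Complex (kerabs b1 b2 c1 c2 z w u eta * cos t)
          (- (kerabs b1 b2 c1 c2 z w u eta * sin t)).
Proof.
rewrite /= /kerT invfM !inv_cpow /kerabs cosD sinD.
move: (rho u `^ b1) (rho eta `^ b2) (cabs _ `^ (- c1)) (cabs _ `^ (- c2)) => r1 r2 M1 M2.
move: (cos (c1 * _)) (sin (c1 * _)) (cos (c2 * _)) (sin (c2 * _)) => x1 y1 x2 y2.
by simpc; congr Complex; ring.
Qed.

Lemma kerSE (b1 b2 c1 c2 : R) (z w u eta : C) :
  kerS b1 b2 c1 c2 z w u eta = Complex (kerabs b1 b2 c1 c2 z w u eta) 0.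
Proof.
rewrite /kerS /kerabs !powRN invfM; congr Complex.
by move: (rho u `^ b1) (rho eta `^ b2) ((_ `^ c1)^-1) ((_ `^ c2)^-1) => r1 r2 M1 M2; ring.
Qed.

Lemma cabs_kerS b1 b2 c1 c2 (z w u eta : C) :
  cabs (kerS b1 b2 c1 c2 z w u eta) = kerabs b1 b2 c1 c2 z w u eta.
Proof.
by rewrite kerSE /cabs /= expr0n addr0 sqrtr_sqr ger0_norm// kerabs_ge0.
Qed.

Lemma cabs_kerT b1 b2 c1 c2 (z w u eta : C) :
  cabs (kerT b1 b2 c1 c2 z w u eta) = kerabs b1 b2 c1 c2 z w u eta.
Proof.
rewrite kerTE /cabs /cre /cim /=; set t := (X in cos X).
move: (kerabs _ _ _ _ _ _ _ _) (kerabs_ge0 b1 b2 c1 c2 z w u eta) => k k0.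
by rewrite sqrrN !exprMn -mulrDr cos2Dsin2 mulr1 sqrtr_sqr ger0_norm.
Qed.

Lemma measurable_invr : measurable_fun setT (fun x : R => x^-1).
Proof.
rewrite (_ : (fun x => _) = (fun x : R => if x == 0 then 0 else
   if x < 0 then - ((- x) `^ (-1)) else x `^ (-1))); last first.
  apply/funext => x; have [->|x0] := eqVneq x 0; first by rewrite invr0.
  case: ltP => h; last by rewrite powR_inv1.
  by rewrite powR_inv1 ?oppr_ge0 ?ltW// invrN opprK.
apply: measurable_fun_ifT => //.
  exact: measurable_fun_eqr.
apply: measurable_fun_ifT => //.
- exact: measurable_fun_ltr.
- apply: measurableT_comp => //.
  exact: (measurableT_comp (measurable_powR (-1)) (@oppr_measurable R setT)).
Qed.

Lemma measurable_arg z : measurable_fun setT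
  (fun u : C => atan (cim (rho2 z u) / cre (rho2 z u))).
Proof.
apply: (measurableT_comp (f := @atan R)).
  by apply: continuous_measurable_fun; exact: continuous_atan.
apply: measurable_funM; first exact: measurable_cim_rho2.
exact: (measurableT_comp measurable_invr (measurable_cre_rho2 z)).
Qed.

Lemma measurable_kerT b1 b2 c1 c2 (z w : C) :
  measurable_fun setT (fun q : C * C => cre (kerT b1 b2 c1 c2 z w q.1 q.2)) /\
  measurable_fun setT (fun q : C * C => cim (kerT b1 b2 c1 c2 z w q.1 q.2)).
Proof.
have mt : measurable_fun setT (fun q : C * C =>
    c1 * atan (cim (rho2 z q.1) / cre (rho2 z q.1)) +
    c2 * atan (cim (rho2 w q.2) / cre (rho2 w q.2))).
  apply: measurable_funD; apply: measurable_funM => //.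
    exact: (measurableT_comp (measurable_arg z) measurable_fst).
  exact: (measurableT_comp (measurable_arg w) measurable_snd).
have mk := measurable_kerabs b1 b2 c1 c2 z w.
split; under eq_fun do rewrite kerTE /cre /cim /=.
  apply: measurable_funM => //; apply: (measurableT_comp (f := @cos R)) => //.
  by apply: continuous_measurable_fun; exact: continuous_cos.
apply: measurableT_comp => //.
apply: measurable_funM => //; apply: (measurableT_comp (f := @sin R)) => //.
by apply: continuous_measurable_fun; exact: continuous_sin.
Qed.

Lemma measurable_kerS b1 b2 c1 c2 (z w : C) :
  measurable_fun setT (fun q : C * C => cre (kerS b1 b2 c1 c2 z w q.1 q.2)) /\
  measurable_fun setT (fun q : C * C => cim (kerS b1 b2 c1 c2 z w q.1 q.2)).
Proof.
split; under eq_fun do rewrite kerSE /cre /cim /=; last exact: measurable_cst.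
exact: measurable_kerabs.
Qed.

(** For Re rho(z,u) > 0 this bounds the principal argument of rho(z,u) by atan eps in modulus,
    without a division. *)
Definition narrow (eps : R) (z u : C) :=
  `|cim (rho2 z u)| <= eps * cre (rho2 z u).

(** On sectors of small opening there is no cancellation beyond a factor 1/2. The opening may depend
    on the parameters of the kernel, but not on the points. *)
Definition coercive (K : C -> C -> C -> C -> R[i]) (b1 b2 c1 c2 : R) :=
  exists2 eps : R, 0 < eps & forall z w u eta, T z -> T w -> T u -> T eta ->
    narrow eps z u -> narrow eps w eta ->
    2^-1 * kerabs b1 b2 c1 c2 z w u eta <= cre (K z w u eta).

Lemma coercive_kerS b1 b2 c1 c2 :
  coercive (@kerS R m.+1 b1 b2 c1 c2) b1 b2 c1 c2.
Proof.
exists 1 => // z w u eta _ _ _ _ _ _; rewrite kerSE /cre /=.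
have := kerabs_ge0 b1 b2 c1 c2 z w u eta; lra.
Qed.

(** The phase of the kernel is, up to sign, c1 arg rho(z,u) + c2 arg rho(w,eta); it suffices to make
    both arguments so small that its cosine is at least 1/2. *)
Lemma coercive_kerT b1 b2 c1 c2 :
  coercive (@kerT R m.+1 b1 b2 c1 c2) b1 b2 c1 c2.
Proof.
have [d d0 dP] : exists2 d : R, 0 < d & forall x, `|x| < d -> 2^-1 <= cos x.
  have := @continuous_cos R 0; move/cvgrPdist_lt/(_ 2^-1); rewrite invr_gt0 ltr0n.
  move=> /(_ isT); rewrite near_simpl => /nbhs_ballP[d d0 dP]; exists d => // x xd.
  have := dP x; rewrite /ball/= sub0r normrN cos0 => /(_ xd).
  by move/ltW; rewrite ler_distlC => /andP[+ _]; lra.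
(* The summand 1 keeps the denominator positive when c1 = c2 = 0 and makes (|c1| + |c2|) d1 < d
   strict. *)
pose d1 := d / (`|c1| + `|c2| + 1).
have cc0 : 0 < `|c1| + `|c2| + 1 by rewrite ltr_wpDl ?addr_ge0.
have d10 : 0 < d1 by rewrite divr_gt0.
have [e e0 eP] : exists2 e : R, 0 < e & forall x : R, `|x| < e -> `|atan x| < d1.
  have := @continuous_atan R 0; move/cvgrPdist_lt/(_ d1 d10).
  rewrite near_simpl => /nbhs_ballP[e e0 eP]; exists e => // x xe.
  by have := eP x; rewrite /ball/= sub0r normrN atan0 sub0r normrN; apply.
(* [narrow] is a non-strict bound while continuity of [atan] gives an open ball, hence half the
   radius. *)
exists (e / 2); first by rewrite divr_gt0.
move=> z w u eta zT wT uT etaT; rewrite /narrow => n1 n2.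
have argP (x y : C) : T x -> T y -> `|cim (rho2 x y)| <= e / 2 * cre (rho2 x y) ->
    `|atan (cim (rho2 x y) / cre (rho2 x y))| < d1.
  move=> xT yT n; have r0 := cre_rho2_gt0 xT yT; apply: eP.
  rewrite normrM normfV (gtr0_norm r0) ltr_pdivrMr//; apply: le_lt_trans n _.
  by rewrite ltr_pM2r// ltr_pdivrMr// ltr_pMr// ltr1n.
rewrite kerTE /cre /= mulrC ler_wpM2l ?kerabs_ge0//; apply: dP.
have h1 := argP _ _ zT uT n1; have h2 := argP _ _ wT etaT n2.
apply: le_lt_trans (ler_normD _ _) _; rewrite !normrM.
apply: (@le_lt_trans _ _ ((`|c1| + `|c2|) * d1)).
  by rewrite mulrDl lerD// ler_wpM2l// ltW.
by rewrite /d1 mulrA ltr_pdivrMr// mulrC ltr_pM2l// ltrDl.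
Qed.

End Kernels.

(** * Testing *)

Section Testing.
Context (R : realType) (m : nat).
Notation C := (Cn R m.+1).
Notation T := (@TB R m.+1).
Notation vol := (@volC R m.+1).

(* The kernel has almost constant phase on Z x supp g, so that the operator with
   parameters (a, b, c) applied to g is at least a multiple of A on Z, while B
   bounds the p-th power of the weighted norm of g. *)
Record tester (a b c p al eps A B : R) (Z : set C) (g h : C -> R) : Prop := Tester {
  tester_mZ : measurable Z ;
  tester_Z_gt0 : (0 < vol Z)%E ;
  tester_ZT : Z `<=` T ;
  tester_mg : measurable_fun setT g ;
  tester_mh : measurable_fun setT h ;
  tester_g0 : forall u, 0 <= g u ;
  tester_h0 : forall u, 0 <= h u ;
  tester_narrow : forall z u, Z z -> T u -> g u != 0 -> narrow eps z u ;
  tester_le : forall z u, Z z -> T u ->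
    h u <= rho z `^ a * (rho u `^ b * cabs (rho2 z u) `^ (- c)) * g u ;
  tester_A0 : 0 <= A ;
  tester_A : (A%:E <= \int[vol]_(u in T) (h u)%:E)%E ;
  tester_B : (\int[vol]_(u in T) (g u `^ p * rho u `^ al)%:E <= B%:E)%E }.

(** The inner integral is g2(w)^p1 times a constant; the power p2/p1 turns it into g2(w)^p2 times a
    constant, so the norm splits. *)
Lemma mixnorm_tensor (p1 p2 al1 al2 B1 B2 : R) (g1 g2 : C -> R) :
  0 < p1 -> 0 < p2 ->
  measurable_fun setT g1 -> (forall u, 0 <= g1 u) ->
  measurable_fun setT g2 -> (forall u, 0 <= g2 u) ->
  (\int[vol]_(u in T) (g1 u `^ p1 * rho u `^ al1)%:E <= B1%:E)%E ->
  (\int[vol]_(u in T) (g2 u `^ p2 * rho u `^ al2)%:E <= B2%:E)%E ->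
  (mixnorm p1 p2 al1 al2 (fun q : C * C => Complex (g1 q.1 * g2 q.2)%R 0%R)
     <= (B1 `^ p1^-1 * B2 `^ p2^-1)%:E)%E.
Proof.
move=> p10 p20 mg1 g10 mg2 g20 I1B I2B.
set I1 := (\int[vol]_(u in T) (g1 u `^ p1 * rho u `^ al1)%:E)%E in I1B.
set I2 := (\int[vol]_(u in T) (g2 u `^ p2 * rho u `^ al2)%:E)%E in I2B.
have I10 : (0 <= I1)%E by apply: integral_ge0 => u _; rewrite lee_fin mulr_ge0 ?powR_ge0.
have I20 : (0 <= I2)%E by apply: integral_ge0 => u _; rewrite lee_fin mulr_ge0 ?powR_ge0.
have mI p al (g : C -> R) : measurable_fun setT g ->
    measurable_fun T (fun u => (g u `^ p * rho u `^ al)%:E).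
  move=> mg; apply: measurable_funTS; apply/measurable_EFinP; apply: measurable_funM.
    exact: (measurableT_comp (measurable_powR p) mg).
  exact: measurable_powR_rho.
have mT := @measurable_TB R m.
have mixE : mixnorm p1 p2 al1 al2 (fun q : C * C => Complex (g1 q.1 * g2 q.2)%R 0%R)
    = ((I1 `^ (p2 / p1) * I2) `^ p2^-1)%E.
  rewrite /mixnorm; congr (_ `^ _)%E.
  rewrite -ge0_integralZl//; last 3 first.
  - exact: mI.
  - by move=> u _; rewrite lee_fin mulr_ge0 ?powR_ge0.
  - exact: poweR_ge0.
  apply: eq_integral => w _ /=.
  have -> : (\int[vol]_(z in T) ((cabs (Complex (g1 z * g2 w)%R 0%R)) `^ p1 * rho z `^ al1)%:E
      = (g2 w `^ p1)%:E * I1)%E.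
    rewrite /I1 -ge0_integralZl//; last 3 first.
    - exact: mI.
    - by move=> u _; rewrite lee_fin mulr_ge0 ?powR_ge0.
    - by rewrite lee_fin powR_ge0.
    apply: eq_integral => z _; rewrite -EFinM /cabs /cre /cim /= expr0n addr0 sqrtr_sqr.
    by rewrite ger0_norm ?mulr_ge0// powRM// mulrAC mulrC.
  rewrite poweRM ?lee_fin ?powR_ge0// poweR_EFin -powRrM mulrCA mulfV ?gt_eqF// mulr1.
  by rewrite [LHS]muleAC muleC -EFinM.
have B10 : 0 <= B1 by rewrite -lee_fin; exact: le_trans I1B.
have B20 : 0 <= B2 by rewrite -lee_fin; exact: le_trans I2B.
rewrite mixE poweRM ?poweR_ge0// -poweRrM mulrAC mulfV ?gt_eqF// mul1r.
rewrite EFinM -!poweR_EFin; apply: lee_pmul; rewrite ?poweR_ge0//.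
- apply: gt0_ler_poweR => //; [by rewrite invr_ge0 ltW|by rewrite in_itv/= leey andbT|
    by rewrite in_itv/= leey andbT lee_fin].
- apply: gt0_ler_poweR => //; [by rewrite invr_ge0 ltW|by rewrite in_itv/= leey andbT|
    by rewrite in_itv/= leey andbT lee_fin].
Qed.

Lemma integral_tensor (h1 h2 : C -> R) :
  measurable_fun setT h1 -> (forall u, 0 <= h1 u) ->
  measurable_fun setT h2 -> (forall u, 0 <= h2 u) ->
  (\int[@volCC R m.+1]_(q in T `*` T) (h1 q.1 * h2 q.2)%:E =
   \int[vol]_(u in T) (h1 u)%:E * \int[vol]_(u in T) (h2 u)%:E)%E.
Proof.
move=> mh1 h10 mh2 h20; have mT := @measurable_TB R m.
rewrite ge0_integral_volCC; last 2 first.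
- apply/measurable_EFinP; apply: measurable_funM.
    exact: (measurableT_comp mh1 measurable_fst).
  exact: (measurableT_comp mh2 measurable_snd).
- by move=> q; rewrite lee_fin mulr_ge0.
rewrite -ge0_integralZl//; last 3 first.
- by apply: measurable_funTS; exact/measurable_EFinP.
- by move=> u _; rewrite lee_fin.
- by apply: integral_ge0 => u _; rewrite lee_fin.
apply: eq_integral => w _ /=.
rewrite -ge0_integralZr//; last 3 first.
- by apply: measurable_funTS; exact/measurable_EFinP.
- by move=> u _; rewrite lee_fin.
- by rewrite lee_fin.
Qed.

(** Apply the operator to g1(u) g2(eta) and evaluate at a point of Z1 x Z2. What matters is that [D]
    is uniform over all testers with the given parameters. *)
Lemma tester_bound (K : C -> C -> C -> C -> R[i])
    (p1 p2 a1 a2 b1 b2 c1 c2 al1 al2 eps : R) :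
  0 < p1 -> 0 < p2 ->
  bounded_Lp_Linf K a1 a2 p1 p2 al1 al2 ->
  (forall z w u eta, T z -> T w -> T u -> T eta -> narrow eps z u -> narrow eps w eta ->
    2^-1 * kerabs b1 b2 c1 c2 z w u eta <= cre (K z w u eta)) ->
  exists2 D : R, 0 <= D & forall A1 B1 A2 B2 Z1 g1 h1 Z2 g2 h2,
    tester a1 b1 c1 p1 al1 eps A1 B1 Z1 g1 h1 ->
    tester a2 b2 c2 p2 al2 eps A2 B2 Z2 g2 h2 ->
    A1 * A2 <= D * (B1 `^ p1^-1 * B2 `^ p2^-1).
Proof.
move=> p10 p20 [D HD] HK; exists (2 * `|D|); first by rewrite mulr_ge0.
(* In the constant just chosen, the absolute value covers a negative constant in the boundedness
   hypothesis, and the 2 undoes the 1/2 of coercivity. *)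
move=> A1 B1 A2 B2 Z1 g1 h1 Z2 g2 h2 [mZ1 Z10 ZT1 mg1 mh1 g10 h10 n1 l1 A10 LA1 LB1].
move=> [mZ2 Z20 ZT2 mg2 mh2 g20 h20 n2 l2 A20 LA2 LB2].
pose f (q : C * C) : R[i] := Complex (g1 q.1 * g2 q.2) 0.
have mixB := mixnorm_tensor p10 p20 mg1 g10 mg2 g20 LB1 LB2.
have mix0 : (0 <= mixnorm p1 p2 al1 al2 f)%E by exact: poweR_ge0.
have fLp : in_Lp p1 p2 al1 al2 f.
  split; last split.
  - apply: measurable_funM.
      exact: (measurableT_comp mg1 measurable_fst).
    exact: (measurableT_comp mg2 measurable_snd).
  - exact: measurable_cst.
  - exact: le_lt_trans mixB (ltry _).
have [N [[M [mM M0 NM]] HN]] := HD f fLp.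
(* Otherwise Z1 x Z2, of positive measure, would lie in a null set. *)
have [[z w] [/= [zZ wZ] qN]] : exists q, (Z1 `*` Z2) q /\ ~ N q.
  apply: contrapT => /forallNP h.
  have ZN : Z1 `*` Z2 `<=` M.
    by move=> q qZ; apply: NM; apply: contrapT => qN; apply: (h q).
  have : (@volCC R m.+1 (Z1 `*` Z2) <= 0)%E.
    by rewrite -M0 le_measure// inE//; exact: measurableX.
  have -> : @volCC R m.+1 (Z1 `*` Z2) = (vol Z1 * vol Z2)%E.
    exact: (product_measure1E vol vol).
  by rewrite leNgt mule_gt0.
have zT := ZT1 _ zZ; have wT := ZT2 _ wZ.
have [[intr _] le] := HN (z, w) (conj zT wT) qN; rewrite /= in intr le.
have mTT : measurable (T `*` T) by apply: measurableX; exact: measurable_TB.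
have rr0 : 0 <= rho z `^ a1 * rho w `^ a2 by rewrite mulr_ge0 ?powR_ge0.
have low q : (T `*` T) q -> 2^-1 * (h1 q.1 * h2 q.2) <=
    rho z `^ a1 * rho w `^ a2 * cre (integrand K f z w q).
  case: q => u eta [/= uT etaT].
  have -> : cre (integrand K f z w (u, eta)) = cre (K z w u eta) * (g1 u * g2 eta).
    by rewrite /integrand /f /=; case: (K _ _ _ _) => x y; rewrite /cre /= mulr0 subr0.
  have kle : h1 u * h2 eta <= rho z `^ a1 * rho w `^ a2 *
      (kerabs b1 b2 c1 c2 z w u eta * (g1 u * g2 eta)).
    apply: le_trans (ler_pM (h10 u) (h20 eta) (l1 _ _ zZ uT) (l2 _ _ wZ etaT)) _.
    rewrite /kerabs le_eqVlt; apply/orP; left; apply/eqP.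
    move: (rho z `^ _) (rho w `^ _) (rho u `^ _) (rho eta `^ _) (cabs (rho2 z u) `^ _).
    by move: (cabs (rho2 w eta) `^ _) (g1 u) (g2 eta) => *; ring.
  (* Where g1 or g2 vanishes the phase is not controlled, but there [kle] already gives h1 h2 <=
     0. *)
  have [g1u|g1u] := eqVneq (g1 u) 0.
    by move: kle; rewrite g1u mul0r !mulr0; lra.
  have [g2u|g2u] := eqVneq (g2 eta) 0.
    by move: kle; rewrite g2u !mulr0; lra.
  apply: le_trans (ler_wpM2l _ kle) _; first by rewrite invr_ge0.
  rewrite [leLHS]mulrCA; apply: ler_wpM2l => //; rewrite [leLHS]mulrA.
  apply: ler_wpM2r; first exact: mulr_ge0.
  by apply: HK => //; [exact: n1|exact: n2].
have cre0 q : (T `*` T) q -> 0 <= rho z `^ a1 * rho w `^ a2 * cre (integrand K f z w q).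
  by move=> qT; apply: le_trans (low q qT); rewrite !mulr_ge0 ?invr_ge0.
set I := (\int[@volCC R m.+1]_(q in T `*` T) (cre (integrand K f z w q))%:E)%E in intr le *.
have If : I \is a fin_num by exact: integrable_fin_num.
have lowI : ((2^-1 * (A1 * A2))%:E <= (rho z `^ a1 * rho w `^ a2)%:E * I)%E.
  apply: (@le_trans _ _ (\int[@volCC R m.+1]_(q in T `*` T)
      ((2^-1)%:E * (h1 q.1 * h2 q.2)%:E))%E).
    rewrite ge0_integralZl//; last 2 first.
    - apply: measurable_funTS; apply/measurable_EFinP; apply: measurable_funM.
        exact: (measurableT_comp mh1 measurable_fst).
      exact: (measurableT_comp mh2 measurable_snd).
    - by move=> q _; rewrite lee_fin mulr_ge0.
    rewrite EFinM integral_tensor//; apply: lee_pmul => //.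
    - by rewrite lee_fin mulr_ge0.
    by rewrite EFinM; apply: lee_pmul; rewrite ?lee_fin.
  rewrite -integralZl//.
  apply: ge0_le_integral => //.
  - by move=> q _; rewrite -EFinM lee_fin !mulr_ge0 ?invr_ge0.
  - apply: measurable_funTS; apply: emeasurable_funM => //.
    apply/measurable_EFinP; apply: measurable_funM.
      exact: (measurableT_comp mh1 measurable_fst).
    exact: (measurableT_comp mh2 measurable_snd).
  - by apply: emeasurable_funM => //; exact: measurable_int intr.
rewrite -(fineK If) -EFinM lee_fin in lowI.
have opge : rho z `^ a1 * rho w `^ a2 * fine I <= cabs (op_val K a1 a2 f z w).
  apply: le_trans (le_trans (ler_norm _) (le_cre_cabs _)).
  by rewrite /op_val /cre /= mul0r subr0.
have mB : fine (mixnorm p1 p2 al1 al2 f) <= B1 `^ p1^-1 * B2 `^ p2^-1.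
  rewrite -lee_fin fineK// ge0_fin_numE//; exact: le_lt_trans mixB (ltry _).
have Dle : D * fine (mixnorm p1 p2 al1 al2 f) <= `|D| * (B1 `^ p1^-1 * B2 `^ p2^-1).
  apply: le_trans (ler_wpM2r _ (ler_norm D)) _; first exact: fine_ge0.
  by apply: ler_wpM2l.
have := le_trans lowI (le_trans opge (le_trans le Dle)).
by rewrite ler_pdivrMl// => h; rewrite -[leRHS]mulrA.
Qed.

End Testing.

(** * Boxes *)

Section Boxes.
Context (R : realType) (m : nat).
Notation C := (Cn R m.+1).
Notation T := (@TB R m.+1).
Notation vol := (@volC R m.+1).

(** Using |s| in the constants covers exponents of both signs, as nothing is known about the signs
    of a, b, c during the necessity argument. *)
Lemma powR_compare (s r x : R) : 0 < r -> r <= 4 * x -> x <= 4 * r ->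
  4 `^ (- `|s|) * r `^ s <= x `^ s <= 4 `^ `|s| * r `^ s.
Proof.
move=> r0 rx xr; have x0 : 0 < x by lra.
have mono (t y v : R) : 0 <= t -> 0 < y -> y <= 4 * v -> y `^ t <= 4 `^ t * v `^ t.
  move=> t0 y0 yv; have v0 : 0 < v by lra.
  rewrite -powRM ?(ltW v0)//; apply: ge0_ler_powR => //; rewrite nnegrE ltW//.
  by rewrite mulr_gt0.
have p4 t : 0 < (4 : R) `^ t by exact: powR_gt0.
rewrite powRN ler_pdivrMl//.
have [s0|s0] := leP 0 s.
  by rewrite (ger0_norm s0) !mono.
have ns0 : 0 <= - s by rewrite oppr_ge0 ltW.
have flip (y v : R) : 0 < y -> 0 < v -> v <= 4 * y -> y `^ s <= 4 `^ (- s) * v `^ s.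
  move=> y0 v0 vy; have [t st] : exists t, s = - t by exists (- s); rewrite opprK.
  move: ns0; rewrite st opprK => t0.
  rewrite !(powRN _ t) ler_pdivlMr ?powR_gt0// ler_pdivrMl ?powR_gt0// mulrC.
  exact: mono.
by rewrite (ltr0_norm s0) !flip.
Qed.

Definition ind_le (l x : R) : R := (`|x| <= l)%R%:R.

Lemma ind_le_ge0 l x : 0 <= ind_le l x. Proof. exact: ler0n. Qed.

Lemma measurable_ind_le d (X : measurableType d) (l f : X -> R) :
  measurable_fun setT l -> measurable_fun setT f ->
  measurable_fun setT (fun x => ind_le (l x) (f x)).
Proof.
move=> ml mf.
rewrite (_ : (fun x => _) = (fun x => if `|f x| <= l x then 1 else 0)); last first.
  by apply/funext => x; rewrite /ind_le; case: (_ <= _).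
apply: measurable_fun_ifT => //; apply: measurable_fun_ler => //.
exact: measurableT_comp.
Qed.

Lemma integral_ind_le (l : R) : 0 <= l ->
  (\int[@lebesgue_measure R]_x (ind_le l x)%:E = (2 * l)%:E)%E.
Proof.
move=> l0.
rewrite (eq_integral (fun x : measurableTypeR R => (\1_(`[(- l), l]%classic) x)%:E)).
  rewrite integral_indic//= setIT lebesgue_measure_itv/= lte_fin -EFinD opprK.
  case: ltP => h; first by rewrite mulr_natl mulr2n.
  by congr EFin; lra.
move=> x _; rewrite /ind_le indicE ler_norml; congr ((nat_of_bool _)%:R%:E).
by apply/idP/idP => [h|/set_mem//]; apply/mem_set; rewrite /= in_itv.
Qed.

(** An indicator in all coordinates except y_n, which is left to be restricted through [rho]. The
    sides sqrt(d r) and d r follow the scaling of rho(z,u), and d is small so that the imaginary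
    part stays small. The product form suits [ge0_integral_volC_shear]. *)
Definition box (d r : R) (u : C) : R :=
  (\prod_(j < m) ind_le (Num.sqrt (d * r)) (nth 0 u.1 j) * ind_le (d * r) (nth 0 u.1 m)) *
  \prod_(j < m) ind_le (Num.sqrt (d * r)) (nth 0 u.2 j).

Lemma box_ge0 d r u : 0 <= box d r u.
Proof. by rewrite !mulr_ge0 ?prodr_ge0// => *; exact: ind_le_ge0. Qed.

Lemma boxP d r u : box d r u != 0 ->
  [/\ box d r u = 1, forall j : 'I_m, `|nth 0 u.1 j| <= Num.sqrt (d * r),
      `|nth 0 u.1 m| <= d * r & forall j : 'I_m, `|nth 0 u.2 j| <= Num.sqrt (d * r)].
Proof.
rewrite /box !mulf_eq0 !negb_or => /andP[/andP[h1 h2] h3].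
have ind1 l x : ind_le l x != 0 -> `|x| <= l /\ ind_le l x = 1.
  by rewrite /ind_le; case: (_ <= _) => //; rewrite eqxx.
have prod1 (F : 'I_m -> R) l : \prod_(j < m) ind_le l (F j) != 0 ->
    (forall j, `|F j| <= l) /\ \prod_(j < m) ind_le l (F j) = 1.
  move=> /prodf_neq0 h; split; first by move=> j; have [] := ind1 _ _ (h j isT).
  by apply: big1 => j _; have [] := ind1 _ _ (h j isT).
have [p1 ->] := prod1 _ _ h1; have [p2 ->] := ind1 _ _ h2; have [p3 ->] := prod1 _ _ h3.
by rewrite !mulr1.
Qed.

Lemma box_powR d r u (p : R) : 0 < p -> box d r u `^ p = box d r u.
Proof.
move=> p0; have [->|/boxP[-> _ _ _]] := eqVneq (box d r u) 0.
  by rewrite powR0 ?gt_eqF.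
by rewrite powR1.
Qed.

Lemma box_mono (d r s : R) u : 0 <= d -> r <= s -> box d r u <= box d s u.
Proof.
move=> d0 rs.
have im l l' x : l <= l' -> ind_le l x <= ind_le l' x.
  move=> ll; rewrite /ind_le; have [h|_] := boolP (`|x| <= l)%R; last exact: ler0n.
  by rewrite (le_trans h ll).
have pm (F : 'I_m -> R) : \prod_(j < m) ind_le (Num.sqrt (d * r)) (F j) <=
    \prod_(j < m) ind_le (Num.sqrt (d * s)) (F j).
  apply: ler_prod => j _; rewrite ind_le_ge0/= im// ler_wsqrtr//.
  exact: ler_wpM2l.
have pp l (F : 'I_m -> R) : 0 <= \prod_(j < m) ind_le l (F j).
  by apply: prodr_ge0 => j _; exact: ind_le_ge0.
apply: ler_pM => //; first by rewrite mulr_ge0// ind_le_ge0.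
apply: ler_pM; [exact: pp|exact: ind_le_ge0|exact: pm|].
by apply: im; exact: ler_wpM2l.
Qed.

(** The scale may vary with the point: with scale [rho] the box becomes a nontangential region. *)
Lemma measurable_box d (sc : C -> R) : measurable_fun setT sc ->
  measurable_fun setT (fun u => box d (sc u) u).
Proof.
move=> msc.
have md : measurable_fun setT (fun u => d * sc u) by exact: measurable_funM.
have ms : measurable_fun setT (fun u => Num.sqrt (d * sc u)).
  exact: (measurableT_comp (@measurable_sqrtr R) md).
apply: measurable_funM; first apply: measurable_funM.
- apply: measurable_prod => j _; apply: measurable_ind_le => //.
  exact: measurable_nth1.
- by apply: measurable_ind_le => //; exact: measurable_nth1.
- apply: measurable_prod => j _; apply: measurable_ind_le => //.
  exact: measurable_nth2.
Qed.

(** Volume of the box in the coordinates other than rho: 2m sides 2 sqrt(d r) and one side 2 d r. *)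
Definition box_vol (d r : R) : R := (4 * (d * r)) ^+ m * (2 * (d * r)).

Lemma integral_box (d r : R) (chi : R -> R) (L : R) : 0 <= d * r ->
  measurable_fun setT chi -> (forall x, 0 <= chi x) ->
  (\int[@lebesgue_measure R]_x (chi x)%:E = L%:E)%E ->
  (\int[vol]_u (box d r u * chi (rho u))%:E = (box_vol d r * L)%:E)%E.
Proof.
move=> dr0 mchi chi0 chiL.
have mi l : measurable_fun setT (ind_le l) by exact: measurable_ind_le.
have i0 l x : 0 <= ind_le l x by exact: ind_le_ge0.
have sqE : (\int[@lebesgue_measure R]_x (ind_le (Num.sqrt (d * r)) x)%:E =
    (2 * Num.sqrt (d * r))%:E)%E.
  by apply: integral_ind_le; exact: sqrtr_ge0.
transitivity (\int[vol]_u
    ((\prod_(j < m) ind_le (Num.sqrt (d * r)) (nth 0 u.1 j) *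
      ind_le (d * r) (nth 0 u.1 m - 0)) *
     (\prod_(j < m) ind_le (Num.sqrt (d * r)) (nth 0 u.2 j) * chi (rho u)))%:E)%E.
  by apply: eq_integral => u _; rewrite subr0 /box -mulrA.
rewrite (@ge0_integral_volC_shear R m (fun=> ind_le (Num.sqrt (d * r))) (ind_le (d * r))
  (fun=> ind_le (Num.sqrt (d * r))) chi (fun _ _ => 0) (fun=> 2 * Num.sqrt (d * r))
  (fun=> 2 * Num.sqrt (d * r)) (2 * (d * r)) L)//; last exact: integral_ind_le.
rewrite !prodr_const card_ord /box_vol; congr EFin.
rewrite mulrACA -exprMn.
have -> : 2 * Num.sqrt (d * r) * (2 * Num.sqrt (d * r)) = 4 * (d * r).
  by rewrite mulrACA -[X in _ * X]expr2 sqr_sqrtr//; ring.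
by rewrite mulrA.
Qed.

(* (2m+1) d r bounds the imaginary part of rho2 on boxes of scale r. *)
Lemma box_narrow (eps d r : R) z u : 0 < d -> (2 * m%:R + 1) * d <= 1 ->
  (2 * m%:R + 1) * d <= eps / 2 -> 0 < r -> T z -> T u ->
  r <= rho z + rho u -> rho z + rho u <= 4 * r ->
  box d r z != 0 -> box d r u != 0 ->
  [/\ narrow eps z u, r <= 4 * cabs (rho2 z u) & cabs (rho2 z u) <= 4 * r].
Proof.
move=> d0 md1 mde r0 zT uT lo hi /boxP[_ z1 z2 z3] /boxP[_ u1 u2 u3].
have dr0 : 0 < d * r by rewrite mulr_gt0.
set l := Num.sqrt (d * r) in z1 z3 u1 u3.
have l0 : 0 <= l by exact: sqrtr_ge0.
have ll : l * l = d * r by rewrite -expr2 sqr_sqrtr// ltW.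
have diff (x y : R) : `|x| <= l -> `|y| <= l -> (x - y) ^+ 2 <= 4 * (d * r).
  move=> xl yl; have h : `|x - y| <= 2 * l.
    by apply: le_trans (ler_normB _ _) _; lra.
  rewrite -real_normK ?num_real// -ll (_ : 4 * (l * l) = (2 * l) ^+ 2); last by ring.
  by apply: lerXn2r => //; rewrite nnegrE// mulr_ge0.
have lre := rho_add_le_cre z u.
have re_hi : cre (rho2 z u) <= 2 * m%:R * (d * r) + 2 * r.
  rewrite rho2E /cre /=.
  have : \sum_(j < m) ((nth 0 z.1 j - nth 0 u.1 j) ^+ 2 +
      (nth 0 z.2 j - nth 0 u.2 j) ^+ 2) <= \sum_(j < m) (8 * (d * r)).
    apply: ler_sum => j _; have := diff _ _ (z1 j) (u1 j); have := diff _ _ (z3 j) (u3 j).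
    lra.
  rewrite sumr_const card_ord -mulr_natl; lra.
have im_hi : `|cim (rho2 z u)| <= (2 * m%:R + 1) * d * r.
  rewrite rho2E /cim /= normrM ger0_norm ?invr_ge0// ler_pdivrMl//.
  apply: le_trans (ler_normB _ _) _.
  have : `|\sum_(j < m) (nth 0 z.1 j - nth 0 u.1 j) * (nth 0 z.2 j + nth 0 u.2 j)| <=
      \sum_(j < m) (4 * (d * r)).
    apply: le_trans (ler_norm_sum _ _ _) _; apply: ler_sum => j _.
    rewrite normrM (_ : 4 * (d * r) = (2 * l) * (2 * l)); last by rewrite -ll; ring.
    apply: ler_pM => //; [apply: le_trans (ler_normB _ _) _|apply: le_trans (ler_normD _ _) _].
      by have := z1 j; have := u1 j; lra.
    by have := z3 j; have := u3 j; lra.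
  have : `|nth 0 z.1 m - nth 0 u.1 m| <= 2 * (d * r).
    by apply: le_trans (ler_normB _ _) _; lra.
  rewrite sumr_const card_ord -mulr_natl; lra.
have mdr : (2 * m%:R + 1) * d * r <= r by rewrite -[leRHS]mul1r ler_wpM2r// ltW.
have mder : (2 * m%:R + 1) * d * r <= eps / 2 * r by rewrite ler_wpM2r// ltW.
have eps0 : 0 < eps.
  have : 0 < (2 * m%:R + 1) * d by rewrite mulr_gt0// ltr_wpDl// mulr_ge0.
  lra.
(* Since Re rho(z,u) >= r/2, the bound (eps/2) r on the imaginary part is at most eps Re
   rho(z,u). *)
split.
- rewrite /narrow; apply: le_trans im_hi (le_trans mder _).
  rewrite -mulrA ler_pM2l//; lra.
- have := cre_rho2_le zT uT; lra.
- apply: le_trans (cabs_le_add _) _.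
  rewrite ger0_norm ?ltW ?cre_rho2_gt0//.
  have : 2 * m%:R * (d * r) + d * r = (2 * m%:R + 1) * d * r by ring.
  lra.
Qed.

Definition zone (d r : R) : set C :=
  [set u | box d r u != 0 /\ r < rho u < 2 * r].

Lemma indic_zone d r u :
  \1_(zone d r) u = box d r u * \1_(`]r, (2 * r)[%classic) (rho u) :> R.
Proof.
rewrite !indicE; have [b0|b0] := eqVneq (box d r u) 0.
  by rewrite b0 mul0r memNset// => -[]; rewrite b0 eqxx.
have [-> _ _ _] := boxP b0; rewrite mul1r; congr (nat_of_bool _)%:R.
apply/idP/idP => /set_mem h; apply/mem_set; first by rewrite /= in_itv/=; case: h.
by split => //; move: h; rewrite /= in_itv.
Qed.

Lemma measurable_zone d r : measurable (zone d r).
Proof.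
have -> : zone d r = (fun u => \1_(zone d r) u : R) @^-1` [set 1].
  apply/seteqP; split => u /=; rewrite indicE; first by move=> uz; rewrite mem_set.
  by case: (boolP (u \in zone d r)) => [/set_mem//|_ /eqP]; rewrite eq_sym oner_eq0.
rewrite -[X in measurable X]setTI.
suff mz : measurable_fun setT (fun u : C => \1_(zone d r) u : R) by exact: mz.
under eq_fun do rewrite indic_zone.
apply: measurable_funM; first exact: measurable_box.
by apply: (measurableT_comp _ (@measurable_rho R m)); exact: measurable_indic.
Qed.

Lemma vol_zone_gt0 (d r : R) : 0 < d -> 0 < r -> (0 < vol (zone d r))%E.
Proof.
move=> d0 r0; have dr0 : 0 < d * r by rewrite mulr_gt0.
rewrite -[zone d r]setIT -integral_indic//; last exact: measurable_zone.
under eq_integral do rewrite indic_zone.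
rewrite (@integral_box d r _ r)// ?(ltW dr0)//.
- by rewrite lte_fin !mulr_gt0// exprn_gt0// mulr_gt0.
- rewrite integral_indic//= setIT lebesgue_measure_itv/= lte_fin ifT; last by lra.
  by rewrite -EFinD; congr EFin; ring.
Qed.

End Boxes.

(** * Test functions *)

Section Necessity.
Context (R : realType) (m : nat).
Notation C := (Cn R m.+1).
Notation T := (@TB R m.+1).
Notation vol := (@volC R m.+1).

Ltac nonneg :=
  repeat first [exact: box_ge0 | exact: powR_ge0 | by [] | apply: mulr_ge0].

Lemma ge0_integral_TB (F : C -> R) : (forall u, F u != 0 -> 0 < rho u) ->
  (\int[vol]_(u in T) (F u)%:E = \int[vol]_u (F u)%:E)%E.
Proof.
move=> FT; rewrite integral_mkcond; apply: eq_integral => u _; rewrite /patch.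
case: ifPn => // uT; congr EFin; apply/esym/eqP; apply: contraNT uT => Fu.
by apply/mem_set; exact: FT.
Qed.

(** Common frame of the three families of test functions. The conditions on [sc] are those of
    [box_narrow] at scale sc(rho(u)) when rho(z) lies between r1 and 2 r1: r1 <= sc places z in the
    larger box, the other two bracket rho(z) + rho(u). Hence |rho(z,u)| is comparable to sc(rho(u)),
    which replaces it in [h], and only integrals in rho remain. *)
Lemma box_tester (a b c p al eps d r1 A B : R) (sc w : R -> R) :
  0 < p -> 0 < d -> (2 * m%:R + 1) * d <= 1 -> (2 * m%:R + 1) * d <= eps / 2 -> 0 < r1 ->
  measurable_fun setT sc -> measurable_fun setT w -> (forall t, 0 <= w t) ->
  (forall t, w t != 0 ->
    [/\ 0 < t, r1 <= sc t, sc t <= r1 + t & 2 * r1 + t <= 4 * sc t]) ->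
  0 <= A ->
  (A%:E <= \int[vol]_u (box d (sc (rho u)) u *
     (rho u `^ b * sc (rho u) `^ (- c) * w (rho u)))%:E)%E ->
  (\int[vol]_u (box d (sc (rho u)) u * (w (rho u) `^ p * rho u `^ al))%:E <= B%:E)%E ->
  tester a b c p al eps (4 `^ (- `|a|) * 4 `^ (- `|c|) * r1 `^ a * A) B (zone d r1)
    (fun u : C => box d (sc (rho u)) u * w (rho u))
    (fun u : C => 4 `^ (- `|a|) * 4 `^ (- `|c|) * r1 `^ a * (box d (sc (rho u)) u *
       (rho u `^ b * sc (rho u) `^ (- c) * w (rho u)))).
Proof.
move=> p0 d0 md1 mde r10 msc mw w0 wP A0 LA LB.
set k := 4 `^ _ * _ * _.
have k0 : 0 <= k by rewrite !mulr_ge0 ?powR_ge0.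
have mscr : measurable_fun setT (fun u : C => sc (rho u)).
  exact: (measurableT_comp msc (@measurable_rho R m)).
have mwr : measurable_fun setT (fun u : C => w (rho u)).
  exact: (measurableT_comp mw (@measurable_rho R m)).
have mb : measurable_fun setT (fun u : C => box d (sc (rho u)) u) by exact: measurable_box.
have mF : measurable_fun setT (fun u : C => box d (sc (rho u)) u *
    (rho u `^ b * sc (rho u) `^ (- c) * w (rho u))).
  apply: measurable_funM => //; apply: measurable_funM => //; apply: measurable_funM.
    exact: measurable_powR_rho.
  exact: (measurableT_comp (measurable_powR (- c)) mscr).
have F0 (u : C) : 0 <= box d (sc (rho u)) u * (rho u `^ b * sc (rho u) `^ (- c) * w (rho u)).
  by nonneg.
have main z u : zone d r1 z -> T u -> box d (sc (rho u)) u * w (rho u) != 0 ->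
    narrow eps z u /\ 4 `^ (- `|c|) * sc (rho u) `^ (- c) <= cabs (rho2 z u) `^ (- c).
  move=> [zb /andP[z1 z2]] uT; rewrite mulf_eq0 negb_or => /andP[ub uw].
  have [t0 s1 s2 s3] := wP _ uw.
  have zT : T z by rewrite /TB /=; lra.
  have zb' : box d (sc (rho u)) z != 0.
    rewrite gt_eqF//; apply: lt_le_trans (box_mono z (ltW d0) s1).
    by rewrite lt_neqAle eq_sym zb box_ge0.
  have sc0 : 0 < sc (rho u) by lra.
  have := @box_narrow R m eps d (sc (rho u)) z u d0 md1 mde sc0 zT uT.
  move=> /(_ _ _ zb' ub)[||nar lo hi]; [lra|lra|split=> //].
  by have /andP[+ _] := powR_compare (- c) sc0 lo hi; rewrite normrN.
split => //.
- exact: measurable_zone.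
- exact: vol_zone_gt0.
- by move=> u [_ /andP[h _]]; rewrite /TB /=; lra.
- exact: measurable_funM.
- exact: measurable_funM.
- by move=> u; nonneg.
- by move=> u; exact: mulr_ge0.
- by move=> z u zZ uT gu; have [] := main z u zZ uT gu.
- move=> z u zZ uT.
  have [g0|g0] := eqVneq (box d (sc (rho u)) u * w (rho u)) 0.
    by rewrite [X in k * X]mulrCA g0 !mulr0.
  have [_ cle] := main z u zZ uT g0.
  have [_ /andP[z1 z2]] := zZ.
  have ale : 4 `^ (- `|a|) * r1 `^ a <= rho z `^ a.
    have [||] := andP (@powR_compare R a r1 (rho z) r10 _ _) => //; lra.
  rewrite /k; set x := box _ _ _ in g0 *; set y := w _ in g0 *.
  have xy0 : 0 <= x * y by apply: mulr_ge0; [exact: box_ge0|exact: w0].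
  apply: (@le_trans _ _ ((4 `^ (- `|a|) * r1 `^ a) *
      (rho u `^ b * (4 `^ (- `|c|) * sc (rho u) `^ (- c))) * (x * y))).
    have E (q1 q2 q3 q4 q5 x' y' : R) : q1 * q2 * q3 * (x' * (q4 * q5 * y')) =
      q1 * q3 * (q4 * (q2 * q5)) * (x' * y') by ring.
    by rewrite E.
  apply: ler_wpM2r => //; apply: ler_pM => //; rewrite ?mulr_ge0 ?powR_ge0//.
  by apply: ler_wpM2l; rewrite ?powR_ge0.
- exact: mulr_ge0.
- rewrite ge0_integral_TB; last first.
    by move=> u; rewrite !mulf_eq0 !negb_or => /andP[_ /andP[_ /andP[_ /wP[]]]].
  under eq_integral do rewrite EFinM.
  rewrite ge0_integralZl//; last 2 first.
  + exact/measurable_EFinP.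
  + by move=> u _; rewrite lee_fin.
  by rewrite EFinM lee_wpmul2l// lee_fin.
- apply: le_trans LB; rewrite ge0_integral_TB; last first.
    move=> u; rewrite mulf_eq0 negb_or => /andP[+ _]; rewrite powR_eq0 (gt_eqF p0) andbT.
    by rewrite mulf_eq0 negb_or => /andP[_ /wP[]].
  rewrite le_eqVlt; apply/orP; left; apply/eqP; apply: eq_integral => u _.
  by rewrite powRM ?box_ge0// box_powR// mulrA.
Qed.

(** If E is nonzero, r = (M + 1)^(1/E) gives the value M + 1; this r is large or small according to
    the sign of E. *)
Lemma powR_bounded (E M : R) : (forall r, 0 < r -> r `^ E <= M) -> E = 0.
Proof.
move=> h; apply/eqP; apply: contraT => E0.
have M1 : 1 <= M by have := h 1 ltr01; rewrite powR1.
have M0 : 0 < M + 1 by lra.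
have := h ((M + 1) `^ E^-1) (powR_gt0 _ M0).
rewrite -powRrM mulVf// powRr1 ?(ltW M0)//; lra.
Qed.

(** Dividing by X^(1/p) bounds X^(1 - 1/p) for arbitrarily large X. Only X >= L is asked, since the
    integral of the test at infinity is known only from below. *)
Lemma sublinear_contra (p k D : R) : 1 < p -> 0 < k ->
  (forall L, 0 < L -> exists2 X, L <= X & k * X <= D * X `^ p^-1) -> False.
Proof.
move=> p1 k0 h; have p0 : 0 < p by lra.
have ip : p^-1 < 1 by rewrite invf_lt1.
suff /powR_bounded : forall r, 0 < r -> r `^ (1 - p^-1) <= D / k by lra.
move=> L L0; have [X LX hX] := h L L0; have X0 : 0 < X by lra.
apply: (@le_trans _ _ (X `^ (1 - p^-1))).
  by apply: ge0_ler_powR; rewrite ?nnegrE ?(ltW L0) ?(ltW X0)//; lra.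
rewrite powRB; last by rewrite (gt_eqF X0) implybT.
rewrite powRr1 ?(ltW X0)// ler_pdivrMr ?powR_gt0// mulrAC ler_pdivlMr//.
by rewrite mulrC.
Qed.

(** The source of the exponent n + 1: the extra factor r is the extent in rho. *)
Lemma box_volE (d r : R) : 0 < r -> box_vol m d r * r = box_vol m d 1 * r `^ m.+2%:R.
Proof.
move=> r0; rewrite /box_vol mulr1 powR_mulrn ?ltW// (mulrA 4) exprMn !exprS.
by ring.
Qed.

(** The indicator of a box with r < rho < 2r. The lower bound scales like r^(a+b-c+m+2) and the norm
    power like r^(al+m+2), with constants free of r; comparing them for all r > 0 determines c. *)
Lemma dilation_tester (a b c p al eps d r : R) :
  0 < p -> 0 < d -> (2 * m%:R + 1) * d <= 1 -> (2 * m%:R + 1) * d <= eps / 2 -> 0 < r ->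
  exists (Z : set C) g h, tester a b c p al eps
    (4 `^ (- `|a|) * 4 `^ (- `|c|) * r `^ a *
      (4 `^ (- `|b|) * (r `^ b * r `^ (- c)) * (box_vol m d 1 * r `^ m.+2%:R)))
    (4 `^ `|al| * r `^ al * (box_vol m d 1 * r `^ m.+2%:R)) Z g h.
Proof.
move=> p0 d0 md1 mde r0.
pose w : R -> R := \1_(`]r, (2 * r)[%classic).
have mw : measurable_fun setT w by exact: measurable_indic.
have w0 t : 0 <= w t by rewrite /w indicE.
have wP t : w t != 0 -> w t = 1 /\ r < t < 2 * r.
  rewrite /w indicE; case: (boolP (t \in _)) => [/set_mem h _|]; last by rewrite eqxx.
  by split => //; move: h; rewrite /= in_itv.
have dr0 : 0 <= d * r by rewrite mulr_ge0// ltW.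
have intw : (\int[@lebesgue_measure R]_x (w x)%:E = r%:E)%E.
  rewrite integral_indic//= setIT lebesgue_measure_itv/= lte_fin ifT; last by lra.
  by rewrite -EFinD; congr EFin; ring.
have mb : measurable_fun setT (fun u : C => box d r u) by exact: measurable_box.
have mwr : measurable_fun setT (fun u : C => w (rho u)).
  exact: (measurableT_comp mw (@measurable_rho R m)).
have V := integral_box m dr0 mw w0 intw.
have scaled (k : R) : 0 <= k ->
    (\int[vol]_u (k * (box d r u * w (rho u)))%:E = (k * (box_vol m d r * r))%:E)%E.
  move=> k0; under eq_integral do rewrite EFinM.
  rewrite ge0_integralZl//; last 2 first.
  - by apply/measurable_EFinP; exact: measurable_funM.
  - by move=> u _; rewrite lee_fin; nonneg.
  by rewrite [X in (_ * X)%E]V -EFinM.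
have bv0 : 0 <= box_vol m d r * r.
  by rewrite /box_vol !mulr_ge0 ?exprn_ge0 ?mulr_ge0 ?(ltW d0) ?(ltW r0).
exists (zone d r), (fun u : C => box d r u * w (rho u)).
eexists.
apply: (@box_tester a b c p al eps d r _ _ (fun=> r) w) => //.
- by move=> t /wP[_ /andP[t1 t2]]; split; lra.
- by rewrite -box_volE//; nonneg.
- rewrite -box_volE// -scaled ?mulr_ge0 ?powR_ge0//.
  apply: ge0_le_integral => //.
  + by move=> u _; rewrite lee_fin; nonneg.
  + by apply/measurable_EFinP; apply: measurable_funM => //; exact: measurable_funM.
  + apply/measurable_EFinP; apply: measurable_funM => //; apply: measurable_funM => //.
    by apply: measurable_funM => //; exact: measurable_powR_rho.
  + move=> u _; rewrite lee_fin.
    have [->|/wP[-> /andP[u1 u2]]] := eqVneq (w (rho u)) 0; first by rewrite !mulr0.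
    rewrite !mulr1 mulrC ler_wpM2l ?box_ge0// mulrA ler_wpM2r ?powR_ge0//.
    by have [||] := andP (@powR_compare R b r (rho u) r0 _ _) => //; lra.
- rewrite -box_volE// -scaled ?mulr_ge0 ?powR_ge0//.
  apply: ge0_le_integral => //.
  + by move=> u _; rewrite lee_fin; nonneg.
  + apply/measurable_EFinP; apply: measurable_funM => //; apply: measurable_funM => //.
      exact: (measurableT_comp (measurable_powR p) mwr).
    exact: measurable_powR_rho.
  + by apply/measurable_EFinP; apply: measurable_funM => //; exact: measurable_funM.
  + move=> u _; rewrite lee_fin.
    have [->|/wP[-> /andP[u1 u2]]] := eqVneq (w (rho u)) 0.
      by rewrite powR0 ?gt_eqF// mul0r !mulr0.
    rewrite powR1 mul1r mulr1 mulrC ler_wpM2r ?box_ge0//.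
    by have [||] := andP (@powR_compare R al r (rho u) r0 _ _) => //; lra.
Qed.

(** With w = rho^(-(b+1)) the numerator integrand is exactly 1/rho, while w^p rho^al = rho^(al -
    p(b+1)) is at most 1/rho because rho <= 1 and the condition on b fails. At fixed scale 1 the
    same quantity bounds both sides. *)
Lemma boundary_tester (a b c p al eps d L : R) :
  0 < p -> 0 < d -> (2 * m%:R + 1) * d <= 1 -> (2 * m%:R + 1) * d <= eps / 2 -> 0 < L ->
  p * (b + 1) <= al + 1 ->
  exists (Z : set C) g h, tester a b c p al eps
    (4 `^ (- `|a|) * 4 `^ (- `|c|) * 1 `^ a * (box_vol m d 1 * L))
    (box_vol m d 1 * L) Z g h.
Proof.
move=> p0 d0 md1 mde L0 bal.
(* Chosen so that 1/t has integral exactly L over [[de], 1]. *)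
pose de : R := expR (- L).
have de0 : 0 < de by exact: expR_gt0.
have de1 : de < 1 by rewrite expR_lt1 oppr_lt0.
pose I : R -> R := \1_(`[de, 1]%classic).
pose w t := t `^ (- (b + 1)) * I t.
pose v t := t^-1 * I t.
have I0 t : 0 <= I t by rewrite /I indicE.
have IP t : I t != 0 -> I t = 1 /\ de <= t <= 1.
  rewrite /I indicE; case: (boolP (t \in _)) => [/set_mem h _|]; last by rewrite eqxx.
  by split => //; move: h; rewrite /= in_itv.
have mI : measurable_fun setT I by exact: measurable_indic.
have mw : measurable_fun setT w by apply: measurable_funM => //; exact: measurable_powR.
have mv : measurable_fun setT v by apply: measurable_funM => //; exact: measurable_invr.
have w0 t : 0 <= w t by rewrite mulr_ge0 ?powR_ge0.
have v0 t : 0 <= v t.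
  rewrite /v; have [->|/IP[-> /andP[t1 _]]] := eqVneq (I t) 0; first by rewrite mulr0.
  by rewrite mulr1 invr_ge0; lra.
have wI t : w t != 0 -> de <= t <= 1.
  by rewrite mulf_eq0 negb_or => /andP[_ /IP[]].
have intv : (\int[@lebesgue_measure R]_x (v x)%:E = L%:E)%E.
  transitivity (\int[@lebesgue_measure R]_(x in `[de, 1%R]) (x^-1)%:E)%E.
    rewrite [RHS]integral_mkcond; apply: eq_integral => x _.
    rewrite /v /I indicE /patch; case: ifP => _; first by rewrite mulr1.
    by rewrite mulr0.
  by rewrite integral_invr_cc// ln1 /de expRK sub0r opprK.
have d10 : 0 <= d * 1 by rewrite mulr1 ltW.
have V := integral_box m d10 mv v0 intv.
have bv0 : 0 <= box_vol m d 1 * L.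
  by rewrite /box_vol !mulr_ge0 ?exprn_ge0 ?mulr_ge0 ?(ltW d0) ?(ltW L0).
exists (zone d 1), (fun u : C => box d 1 u * w (rho u)).
eexists.
apply: (@box_tester a b c p al eps d 1 _ _ (fun=> 1) w) => //.
- by move=> t /wI/andP[t1 t2]; split; lra.
- rewrite -V le_eqVlt; apply/orP; left; apply/eqP; apply: eq_integral => u _.
  rewrite powR1 mulr1 /v /w.
  have [->|/IP[-> /andP[u1 u2]]] := eqVneq (I (rho u)) 0; first by rewrite !mulr0.
  have u0 : 0 < rho u by lra.
  rewrite !mulr1 -powRD; last by rewrite (gt_eqF u0) implybT.
  by rewrite (_ : b + - (b + 1) = -1) ?powR_inv1 ?(ltW u0)//; ring.
- rewrite -V; apply: ge0_le_integral => //.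
  + by move=> u _; rewrite lee_fin; nonneg.
  + apply/measurable_EFinP; apply: measurable_funM; first exact: measurable_box.
    apply: measurable_funM; last exact: measurable_powR_rho.
    apply: (measurableT_comp (measurable_powR p)).
    exact: (measurableT_comp mw (@measurable_rho R m)).
  + apply/measurable_EFinP; apply: measurable_funM; first exact: measurable_box.
    exact: (measurableT_comp mv (@measurable_rho R m)).
  + move=> u _; rewrite lee_fin ler_wpM2l ?box_ge0// /v /w.
    have [->|/IP[-> /andP[u1 u2]]] := eqVneq (I (rho u)) 0.
      by rewrite !mulr0 powR0 ?gt_eqF// mul0r.
    have u0 : 0 < rho u by lra.
    rewrite !mulr1 -powRrM -powRD; last by rewrite (gt_eqF u0) implybT.
    rewrite -powR_inv1 ?(ltW u0)//; apply: ger_powR; first by rewrite u0.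
    by lra.
Qed.

(** X is the integral of rho^(-(m+2)) over the nontangential region 1 <= rho < 2^N. Each dyadic
    layer contributes at least a fixed amount, so X grows at least linearly in N. *)
Lemma infinity_tester (a b c p al eps d : R) (N : nat) :
  0 < p -> 0 < d -> (2 * m%:R + 1) * d <= 1 -> (2 * m%:R + 1) * d <= eps / 2 ->
  a <= 0 -> c = m.+2%:R + a + b - (m.+2%:R + al) / p ->
  exists X : R, box_vol m d 1 * 2 `^ (- m.+2%:R) * N%:R <= X /\
  exists (Z : set C) g h, tester a b c p al eps
    (4 `^ (- `|a|) * 4 `^ (- `|c|) * 1 `^ a * X) X Z g h.
Proof.
move=> p0 d0 md1 mde a0 cE.
pose I k : R -> R := \1_(`[1, 2 ^+ k[%classic).
have I0 k t : 0 <= I k t by rewrite /I indicE.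
have IP k t : I k t != 0 -> I k t = 1 /\ 1 <= t < 2 ^+ k.
  rewrite /I indicE; case: (boolP (t \in _)) => [/set_mem h _|]; last by rewrite eqxx.
  by split => //; move: h; rewrite /= in_itv.
have mI k : measurable_fun setT (I k) by exact: measurable_indic.
have mIr k : measurable_fun setT (fun u : C => I k (rho u)).
  exact: (measurableT_comp (mI k) (@measurable_rho R m)).
have mb : measurable_fun setT (fun u : C => box d (rho u) u).
  by apply: measurable_box; exact: measurable_rho.
have mbc r : measurable_fun setT (fun u : C => box d r u) by exact: measurable_box.
pose F k (u : C) := box d (rho u) u * (rho u `^ (- m.+2%:R) * I k (rho u)).
have mF k : measurable_fun setT (F k).
  by apply: measurable_funM => //; apply: measurable_funM => //; exact: measurable_powR_rho.
have F0 k u : 0 <= F k u by nonneg.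
pose X k := (\int[vol]_u (F k u)%:E)%E.
have X0 k : (0 <= X k)%E by apply: integral_ge0 => u _; rewrite lee_fin.
(* A crude bound is enough: the region lies in the fixed box of scale 2^k and the integrand is at
   most 1. *)
have Xfin k : X k \is a fin_num.
  rewrite ge0_fin_numE//.
  have intI : (\int[@lebesgue_measure R]_x (I k x)%:E = (2 ^+ k - 1)%:E)%E.
    rewrite integral_indic//= setIT lebesgue_measure_itv/= lte_fin.
    have : 1 <= 2 ^+ k :> R by rewrite exprn_ege1// ler1n.
    by case: ltP => h1 h2; [rewrite -EFinD|congr EFin; lra].
  have d2 : 0 <= d * 2 ^+ k by rewrite mulr_ge0 ?exprn_ge0// ltW.
  apply: le_lt_trans (ltry (box_vol m d (2 ^+ k) * (2 ^+ k - 1))).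
  rewrite -(integral_box m d2 (mI k) (I0 k) intI); apply: ge0_le_integral => //.
  - by move=> u _; rewrite lee_fin.
  - exact/measurable_EFinP.
  - by apply/measurable_EFinP; exact: measurable_funM.
  - move=> u _; rewrite lee_fin /F.
    have [->|/IP[-> /andP[u1 u2]]] := eqVneq (I k (rho u)) 0; first by rewrite !mulr0.
    rewrite !mulr1 -[leRHS]mulr1; apply: ler_pM; rewrite ?box_ge0 ?powR_ge0//.
      by apply: box_mono; [exact: ltW|exact: ltW].
    rewrite powRN invf_le1 ?powR_gt0//; last by lra.
    by rewrite powR_mulrn ?exprn_ege1//; lra.
(* On the layer 2^k <= rho < 2^(k+1), shrink the varying box to scale 2^k and bound the integrand
   below by its value at 2^(k+1). *)
have Xlow k : ((box_vol m d 1 * 2 `^ (- m.+2%:R) * k%:R)%:E <= X k)%E.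
  elim: k => [|k IH]; first by rewrite mulr0.
  pose r : R := 2 ^+ k; have r0 : 0 < r by rewrite exprn_gt0.
  have r1 : 1 <= r by rewrite exprn_ege1// ler1n.
  pose J : R -> R := \1_(`[r, (2 * r)[%classic).
  have J0 t : 0 <= J t by rewrite /J indicE.
  have JP t : J t != 0 -> J t = 1 /\ r <= t < 2 * r.
    rewrite /J indicE; case: (boolP (t \in _)) => [/set_mem h _|]; last by rewrite eqxx.
    by split => //; move: h; rewrite /= in_itv.
  have mJ : measurable_fun setT J by exact: measurable_indic.
  have mJr : measurable_fun setT (fun u : C => J (rho u)).
    exact: (measurableT_comp mJ (@measurable_rho R m)).
  have intJ : (\int[@lebesgue_measure R]_x (J x)%:E = r%:E)%E.
    rewrite integral_indic//= setIT lebesgue_measure_itv/= lte_fin ifT; last by lra.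
    by rewrite -EFinD; congr EFin; ring.
  have dr0 : 0 <= d * r by rewrite mulr_ge0// ltW.
  have V := integral_box m dr0 mJ J0 intJ.
  have r20 : 0 < 2 * r by lra.
  pose q := (2 * r) `^ (- m.+2%:R).
  have q0 : 0 <= q by exact: powR_ge0.
  have qE : q * (box_vol m d r * r) = box_vol m d 1 * 2 `^ (- m.+2%:R).
    have h : r `^ (- m.+2%:R) * r `^ m.+2%:R = 1.
      by rewrite -powRD ?addNr ?powRr0// (gt_eqF r0) implybT.
    by rewrite box_volE// /q powRM ?(ltW r0)// mulrACA h mulr1 mulrC.
  apply: (@le_trans _ _ (X k + \int[vol]_u (q%:E * (box d r u * J (rho u))%:E))%E).
    rewrite ge0_integralZl//; last 2 first.
    - by apply/measurable_EFinP; exact: measurable_funM.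
    - by move=> u _; rewrite lee_fin; nonneg.
    rewrite [X in (_ <= _ + _ * X)%E]V -EFinM qE -(natr1 k) mulrDr mulr1 EFinD.
    exact: leeD.
  rewrite /X -ge0_integralD//; last 4 first.
  - by move=> u _; rewrite lee_fin.
  - exact/measurable_EFinP.
  - by move=> u _; rewrite -EFinM lee_fin; nonneg.
  - by apply: emeasurable_funM => //; apply/measurable_EFinP; exact: measurable_funM.
  apply: ge0_le_integral => //.
  - by move=> u _; rewrite -EFinM -EFinD lee_fin addr_ge0//; nonneg.
  - apply: emeasurable_funD; first exact/measurable_EFinP.
    by apply: emeasurable_funM => //; apply/measurable_EFinP; exact: measurable_funM.
  - exact/measurable_EFinP.
  - move=> u _; rewrite -EFinM -EFinD lee_fin /F.
    have IE : I k.+1 (rho u) = I k (rho u) + J (rho u).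
      rewrite /I /J !indicE -natrD; congr (_%:R).
      rewrite !mem_setE !in_itv/= -/r exprS.
      have [h1|h1] := ltP (rho u) r; have [h2|h2] := ltP (rho u) (2 * r);
        have [h3|h3] := leP 1 (rho u); have [h4|h4] := leP r (rho u) => //=; exfalso; lra.
    rewrite IE [X in _ <= _ * X]mulrDr mulrDr lerD2l.
    have [->|/JP[-> /andP[u1 u2]]] := eqVneq (J (rho u)) 0; first by rewrite !mulr0.
    rewrite !mulr1 mulrC; apply: ler_pM; rewrite ?box_ge0//.
      by apply: box_mono => //; exact: ltW.
    by apply: powR_antitone; rewrite ?oppr_le0//; lra.
exists (fine (X N)); split; first by rewrite -lee_fin fineK.
pose e0 := (m.+2%:R + al) / p.
pose w t := t `^ (- e0) * I N t.
have mw : measurable_fun setT w by apply: measurable_funM => //; exact: measurable_powR.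
have w0 t : 0 <= w t by rewrite mulr_ge0 ?powR_ge0.
have wI t : w t != 0 -> 1 <= t.
  by rewrite mulf_eq0 negb_or => /andP[_ /IP[_ /andP[]]].
exists (zone d 1), (fun u : C => box d (rho u) u * w (rho u)).
eexists.
apply: (@box_tester a b c p al eps d 1 _ _ id w) => //.
- by move=> t /wI t1; split => //; lra.
- exact: fine_ge0.
- rewrite fineK// /X; apply: ge0_le_integral => //.
  + by move=> u _; rewrite lee_fin.
  + exact/measurable_EFinP.
  + apply/measurable_EFinP; apply: measurable_funM => //; apply: measurable_funM.
      by apply: measurable_funM; exact: measurable_powR_rho.
    exact: (measurableT_comp mw (@measurable_rho R m)).
  + move=> u _; rewrite lee_fin /F ler_wpM2l ?box_ge0// /w.
    have [->|/IP[-> /andP[u1 _]]] := eqVneq (I N (rho u)) 0; first by rewrite !mulr0.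
    have u0 : 0 < rho u by lra.
    rewrite !mulr1 -!powRD; try by rewrite (gt_eqF u0) implybT.
    (* The exponent b - c - e0 equals -(m+2) - a, which is at least -(m+2) since a <= 0; the base is
       at least 1. *)
    apply: ler_powR => //; rewrite cE -/e0; lra.
(* Here equality holds: -p e0 + al = -(m+2), so the p-th power of the norm is X itself. *)
- rewrite fineK// /X le_eqVlt; apply/orP; left; apply/eqP; apply: eq_integral => u _.
  rewrite /F /w; congr (_ * _)%:E.
  have [->|/IP[-> /andP[u1 _]]] := eqVneq (I N (rho u)) 0.
    by rewrite !mulr0 powR0 ?gt_eqF// mul0r.
  have u0 : 0 < rho u by lra.
  rewrite !mulr1 -powRrM -powRD; last by rewrite (gt_eqF u0) implybT.
  by congr (_ `^ _); rewrite /e0; field; rewrite gt_eqF.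
Qed.

End Necessity.

(** * From testers to the characterisation in both variables *)

Section Characterization.
Context (R : realType) (m : nat).
Notation C := (Cn R m.+1).
Notation T := (@TB R m.+1).

Lemma small_width (eps : R) : 0 < eps -> exists2 d : R, 0 < d &
  (2 * m%:R + 1) * d <= 1 /\ (2 * m%:R + 1) * d <= eps / 2.
Proof.
move=> eps0; set M : R := 2 * m%:R + 1.
have M0 : 0 < M by rewrite ltr_wpDl// mulr_ge0.
exists (Num.min 1 (eps / 2) / M).
  by rewrite divr_gt0// lt_min ltr01 divr_gt0.
by rewrite mulrC divfK ?gt_eqF// !ge_min !lexx orbT.
Qed.

(** The one-variable core. The equation for c is settled first, by dilations, and then used in the
    test at infinity. *)
Lemma tester_necessity (a b c p al eps D : R) : 1 < p -> 0 < eps ->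
  (forall A B (Z : set C) g h, tester a b c p al eps A B Z g h -> A <= D * B `^ p^-1) ->
  [/\ 0 < a, al + 1 < p * (b + 1) & c = m.+2%:R + a + b - (m.+2%:R + al) / p].
Proof.
move=> p1 eps0 H; have p0 : 0 < p by lra.
have [d d0 [md1 mde]] := small_width eps0.
pose V := box_vol m d 1.
have V0 : 0 < V by rewrite /V /box_vol mulr1 mulr_gt0 ?exprn_gt0 ?mulr_gt0.
have p4 (t : R) : 0 < (4 : R) `^ t by exact: powR_gt0.
pose k := 4 `^ (- `|a|) * 4 `^ (- `|c|) * 1 `^ a.
have k0 : 0 < k by rewrite /k powR1 mulr1 mulr_gt0.
have cE : c = m.+2%:R + a + b - (m.+2%:R + al) / p.
  pose k1 := 4 `^ (- `|a|) * 4 `^ (- `|c|) * 4 `^ (- `|b|) * V.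
  have k10 : 0 < k1.
    by apply: mulr_gt0 => //; apply: mulr_gt0 => //; exact: mulr_gt0.
  pose k2 := D * (4 `^ `|al| * V) `^ p^-1.
  suff /powR_bounded : forall r : R, 0 < r ->
      r `^ (a + (b + - c) + m.+2%:R - (al + m.+2%:R) * p^-1) <= k2 / k1.
    by rewrite [al + _]addrC; lra.
  move=> r r0; have [Z [g [h tst]]] := @dilation_tester R m a b c p al eps d r p0 d0 md1 mde r0.
  have := H _ _ _ _ _ tst; rewrite -/V => hr.
  have rD (x y : R) : r `^ (x + y) = r `^ x * r `^ y.
    by rewrite powRD// (gt_eqF r0) implybT.
  rewrite powRB; last by rewrite (gt_eqF r0) implybT.
  rewrite ler_pdivrMr ?powR_gt0// mulrAC ler_pdivlMr//.
  have -> : r `^ (a + (b + - c) + m.+2%:R) * k1 =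
    4 `^ (- `|a|) * 4 `^ (- `|c|) * r `^ a *
      (4 `^ (- `|b|) * (r `^ b * r `^ (- c)) * (V * r `^ m.+2%:R)).
    have E (x1 x2 x3 y1 y2 y3 y4 v : R) : y1 * (y2 * y3) * y4 * (x1 * x2 * x3 * v) =
      x1 * x2 * y1 * (x3 * (y2 * y3) * (v * y4)) by ring.
    by rewrite (rD _ m.+2%:R) (rD a) (rD b) E.
  apply: le_trans hr _.
  have -> : 4 `^ `|al| * r `^ al * (V * r `^ m.+2%:R) =
      (4 `^ `|al| * V) * r `^ (al + m.+2%:R).
    by rewrite (rD al) mulrACA.
  have c0 : 0 <= 4 `^ `|al| * V by apply: mulr_ge0; [exact: powR_ge0|exact: ltW].
  rewrite powRM ?powR_ge0// /k2.
  by rewrite -powRrM mulrA.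
split => //.
- rewrite ltNge; apply/negP => a0.
  apply: (@sublinear_contra R p k D p1 k0) => L L0.
  pose q := V * 2 `^ (- m.+2%:R).
  have q0 : 0 < q by rewrite mulr_gt0 ?powR_gt0.
  (* Enough dyadic layers, each contributing at least q, to exceed L. *)
  pose N := (Num.truncn (L / q)).+1.
  have [X [XN [Z [g [h tst]]]]] := @infinity_tester R m a b c p al eps d N p0 d0 md1 mde a0 cE.
  exists X; last exact: H tst.
  apply: le_trans XN; rewrite -/V -/q mulrC -ler_pdivrMr//.
  exact/ltW/truncnS_gt.
- rewrite ltNge; apply/negP => bal.
  apply: (@sublinear_contra R p k D p1 k0) => L L0.
  have LV0 : 0 < L / V by rewrite divr_gt0.
  have [Z [g [h tst]]] := @boundary_tester R m a b c p al eps d (L / V) p0 d0 md1 mde LV0 bal.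
  exists L => //; have := H _ _ _ _ _ tst.
  by rewrite -/V (mulrC V (L / V)) divfK ?gt_eqF.
Qed.

Lemma tester_exists (a b c p al eps : R) : 0 < p -> 0 < eps ->
  exists A B (Z : set C) g h, 0 < A /\ tester a b c p al eps A B Z g h.
Proof.
move=> p0 eps0.
have [d d0 [md1 mde]] := small_width eps0.
have [Z [g [h tst]]] := @dilation_tester R m a b c p al eps d 1 p0 d0 md1 mde ltr01.
do 5 eexists; split; last exact: tst.
have V0 : 0 < box_vol m d 1 by rewrite /box_vol mulr1 mulr_gt0 ?exprn_gt0 ?mulr_gt0.
by repeat first [exact: V0 | by apply: powR_gt0 | apply: mulr_gt0].
Qed.

(** The modulus gives sufficiency, coercivity gives necessity, and the right side does not mention
    [K]. *)
Lemma bounded_Lp_Linf_iff (K : C -> C -> C -> C -> R[i])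
    (p1 p2 a1 a2 b1 b2 c1 c2 al1 al2 : R) :
  (forall z w, measurable_fun setT (fun q => cre (K z w q.1 q.2)) /\
               measurable_fun setT (fun q => cim (K z w q.1 q.2))) ->
  (forall z w u eta, cabs (K z w u eta) = kerabs b1 b2 c1 c2 z w u eta) ->
  coercive K b1 b2 c1 c2 ->
  1 < p1 -> 1 < p2 ->
  bounded_Lp_Linf K a1 a2 p1 p2 al1 al2 <->
  [/\ 0 < a1, al1 + 1 < p1 * (b1 + 1) & c1 = m.+2%:R + a1 + b1 - (m.+2%:R + al1) / p1] /\
  [/\ 0 < a2, al2 + 1 < p2 * (b2 + 1) & c2 = m.+2%:R + a2 + b2 - (m.+2%:R + al2) / p2].
Proof.
move=> mK Kabs [eps eps0 Kco] p11 p21; have p10 : 0 < p1 by lra. have p20 : 0 < p2 by lra.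
split; last first.
  move=> [h1 h2]; apply: (bounded_of_kerabs (b1 := b1) (b2 := b2) (c1 := c1) (c2 := c2)) => //.
  - by move=> z w; have [] := mK z w.
  - by move=> z w; have [] := mK z w.
  - by move=> z w u eta _ _ _ _; rewrite Kabs.
move=> bd; have [D D0 HD] := tester_bound p10 p20 bd Kco.
split.
- have [A2 [B2 [Z2 [g2 [h2 [A20 tst2]]]]]] := tester_exists a2 b2 c2 al2 p20 eps0.
  (* With the second tester fixed, its data [A2] and [B2] become part of the constant. *)
  apply: (@tester_necessity a1 b1 c1 p1 al1 eps (D * B2 `^ p2^-1 / A2)) => //.
  move=> A B Z g h tst; have := HD _ _ _ _ _ _ _ _ _ _ tst tst2.
  rewrite -ler_pdivlMr// => /le_trans; apply.
  by rewrite le_eqVlt; apply/orP; left; apply/eqP; ring.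
- have [A1 [B1 [Z1 [g1 [h1 [A10 tst1]]]]]] := tester_exists a1 b1 c1 al1 p10 eps0.
  apply: (@tester_necessity a2 b2 c2 p2 al2 eps (D * B1 `^ p1^-1 / A1)) => //.
  move=> A B Z g h tst; have := HD _ _ _ _ _ _ _ _ _ _ tst1 tst.
  rewrite mulrC -ler_pdivlMr// => /le_trans; apply.
  by rewrite le_eqVlt; apply/orP; left; apply/eqP; ring.
Qed.

End Characterization.

Theorem theorem6p5 (R : realType) (n : nat) (p1 p2 a1 a2 b1 b2 c1 c2 al1 al2 : R) :
  (0 < n)%N -> 1 < p1 -> 1 < p2 -> -1 < al1 -> -1 < al2 ->
  (bounded_Lp_Linf (@kerS R n b1 b2 c1 c2) a1 a2 p1 p2 al1 al2 <->
   bounded_Lp_Linf (@kerT R n b1 b2 c1 c2) a1 a2 p1 p2 al1 al2) /\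
  (bounded_Lp_Linf (@kerT R n b1 b2 c1 c2) a1 a2 p1 p2 al1 al2 <->
   [/\ 0 < a1, al1 + 1 < p1 * (b1 + 1)
     & c1 = n%:R + 1 + a1 + b1 - (n%:R + 1 + al1) / p1] /\
   [/\ 0 < a2, al2 + 1 < p2 * (b2 + 1)
     & c2 = n%:R + 1 + a2 + b2 - (n%:R + 1 + al2) / p2]).
Proof.
(* Writing n = m + 1 makes n + 1 the [m.+2] of the preceding sections. *)
case: n => // m _ p11 p21 _ _; rewrite !natr1.
have S := bounded_Lp_Linf_iff a1 a2 al1 al2 (@measurable_kerS R m b1 b2 c1 c2)
  (@cabs_kerS R m b1 b2 c1 c2) (@coercive_kerS R m b1 b2 c1 c2) p11 p21.
have T := bounded_Lp_Linf_iff a1 a2 al1 al2 (@measurable_kerT R m b1 b2 c1 c2)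
  (@cabs_kerT R m b1 b2 c1 c2) (@coercive_kerT R m b1 b2 c1 c2) p11 p21.
by split; [apply: iff_trans S (iff_sym T)|exact: T].
Qed.
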